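(* For any decreasing quality function $q(\theta)$ with inverse $\theta(q)$, the first-score auction with quasi-linear score $S(q,p)=s(q)-p$, where $s$ satisfies $$s'(q)=C^P_q(q,\theta(q))+\frac{C^I_q(q,\theta(q))}{(1-F(\theta(q)))^{n-1}},$$ has a Bayes–Nash equilibrium in which the strategy of every firm is to choose quality $q(\theta)$ and price $$p(\theta)=C^P(q(\theta),\theta)+\frac{C^I(q(\theta),\theta)+IR(\theta,1)}{(1-F(\theta))^{n-1}},$$ hence score $S(\theta)=s(q(\theta))-p(\theta)$; in this equilibrium the most efficient firm (the one with the lowest type) gets the contract, and the expected profit of every firm type is non-negative.
   Context: Setting. A buyer procures one contract from $n\ge2$ firms. Firm $i$ has a private type $\theta_i\in[0,1]$; types are independent with cdf $F$ and strictly positive density $f$. $V(q)$ is the buyer's value of quality $q\ge0$; $C^P(q,\theta)$ and $C^I(q,\theta)$ are production (winner-pay) and investment (all-pay) costs; all derivatives used are assumed to exist. Each firm, knowing only its own type, chooses a quality $q_i\ge0$ and a price bid; its profit is $t_i-C^P(q_i,\theta_i)z_i-C^I(q_i,\theta_i)$ ($z_i$ its share of the contract, $t_i$ the transfer to it). A quality function is a map $q(\cdot)$ from types in $[0,1]$ to qualities in $\mathbb R_+$. Virtual costs: $\tilde C^P=C^P+C^P_\theta F/f$, $\tilde C^I=C^I+C^I_\theta F/f$ (subscripts denote partial derivatives). Standing assumptions. $C^P_q>0$, $C^P_\theta>0$, $C^P_{q\theta}>0$; $C^I_q>0$, $C^I_\theta>0$, $C^I_{q\theta}>0$ for $q>0$;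 $C^I(0,\theta)=0$, $C^I_q(0,\theta)=0$; $V'\ge0$, $V''\le0$; $\tilde C^P_\theta>0$, $\tilde C^P_{qq}>0$, $\tilde C^P_{q\theta}\ge0$; $\tilde C^I_\theta>0$ for $q>0$, $\tilde C^I_{qq}>0$, $\tilde C^I_{q\theta}\ge0$. For every $\theta$: $V'(q)>\tilde C^P_q(q,\theta)$ at $q=0$, and $V'(q)<\tilde C^P_q(q,\theta)+\tilde C^I_q(q,\theta)$ at $q=\infty$ (i.e. for all large $q$). Informational rents: $IR(\theta,\theta')=\int_\theta^{\theta'}\big[C^P_\theta(q(u),u)(1-F(u))^{n-1}+C^I_\theta(q(u),u)\big]du$. First-score auction with score $s(q)-p$: the message of firm $i$ is a price $m_i\in\mathbb R_+$. With $W=\{i: s(q_i)-m_i=\max_j(s(q_j)-m_j)\}$, $z_i=\mathbb I(i\in W)/|W|$ and $t_i=m_iz_i$. Bayes–Nash equilibrium: for every firm and every type, the prescribed (quality, price) pair maximizes interim expected profit over all pairs $(q',m')\in\mathbb R_+\times\mathbb R_+$, given the others' strategies.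
   Formalization: Assumes C^P ≥ 0 so that prices lie in R_+; drops type 1 when q(1)>0, where p(1) is infinite, and reads 0/0 as 0 when q(1)=0; extends θ(q) monotonically off the range of q (jump points, 0 above q(0)), takes s as a right limit where θ(q) reaches 1 and s = −∞ below. *)

(* Defs.v *)
(* MathComp-Analysis, over an abstract [R : realType]. *)
From HB Require Import structures.
From mathcomp Require Import all_boot all_order all_algebra.
From mathcomp Require Import all_classical all_reals all_analysis.
Import Order.TTheory GRing.Theory Num.Theory.
Import numFieldNormedType.Exports.

Set Implicit Arguments.
Unset Strict Implicit.
Unset Printing Implicit Defensive.

Local Open Scope classical_set_scope.
Local Open Scope ring_scope.

(* Derivative relative to a domain [D]: the usual derivative at interior points
   of [D], the one-sided one at its end points (qualities range over
   [0, +oo[ and types over [0, 1], and boundary derivatives do matter). *)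
Definition diff_quot (R : realType) (f : R -> R) (x : R) : R -> R :=
  fun y => (f y - f x) / (y - x).

Definition derivable_in (R : realType) (D : set R) (f : R -> R) (x : R) : Prop :=
  cvg (diff_quot f x @ within D x^').

Definition derive_in (R : realType) (D : set R) (f : R -> R) (x : R) : R :=
  lim (diff_quot f x @ within D x^').

Definition qualities (R : realType) : set R := [set x | 0 <= x].
Definition types (R : realType) : set R := [set t | 0 <= t <= 1].
Arguments qualities {R}.
Arguments types {R}.

(* For C : quality -> type -> cost, [dq (dt C)] is the q-derivative of
   C_theta, and [dt (dq C)] is C_{q theta}. *)
Definition dq (R : realType) (C : R -> R -> R) : R -> R -> R :=
  fun x t => derive_in qualities (C ^~ t) x.
Definition dt (R : realType) (C : R -> R -> R) : R -> R -> R :=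
  fun x t => derive_in types (C x) t.

Definition has_dq (R : realType) (C : R -> R -> R) : Prop :=
  forall x t, qualities x -> types t -> derivable_in qualities (C ^~ t) x.
Definition has_dt (R : realType) (C : R -> R -> R) : Prop :=
  forall x t, qualities x -> types t -> derivable_in types (C x) t.

(* The partial derivatives that enter C_q, C_theta, C_{q theta} and the
   derivatives of the virtual cost C + C_theta F / f. *)
Record differentiable_cost (R : realType) (C : R -> R -> R) : Prop := {
  cost_q : has_dq C;
  cost_t : has_dt C;
  cost_qq : has_dq (dq C);
  cost_qt : has_dt (dq C);
  cost_tq : has_dq (dt C);
  cost_tt : has_dt (dt C);
  cost_tqq : has_dq (dq (dt C));
  cost_tqt : has_dt (dq (dt C)) }.

Definition virtual (R : realType) (F f : R -> R) (C : R -> R -> R)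
    : R -> R -> R :=
  fun x t => C x t + dt C x t * F t / f t.

Record standing_assumptions (R : realType) (F f V : R -> R)
    (CP CI : R -> R -> R) : Prop := {
  CP_diff : differentiable_cost CP;
  CI_diff : differentiable_cost CI;
  V_diff : forall x, qualities x -> derivable_in qualities V x;
  V_diff2 : forall x, qualities x ->
    derivable_in qualities (derive_in qualities V) x;
  CP_ge0 : forall x t, qualities x -> types t -> 0 <= CP x t;
  CP_q_gt0 : forall x t, qualities x -> types t -> 0 < dq CP x t;
  CP_t_gt0 : forall x t, qualities x -> types t -> 0 < dt CP x t;
  CP_qt_gt0 : forall x t, qualities x -> types t -> 0 < dt (dq CP) x t;
  CI_q_gt0 : forall x t, 0 < x -> types t -> 0 < dq CI x t;
  CI_t_gt0 : forall x t, 0 < x -> types t -> 0 < dt CI x t;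
  CI_qt_gt0 : forall x t, 0 < x -> types t -> 0 < dt (dq CI) x t;
  CI_0 : forall t, types t -> CI 0 t = 0;
  CI_q_0 : forall t, types t -> dq CI 0 t = 0;
  V_q_ge0 : forall x, qualities x -> 0 <= derive_in qualities V x;
  V_qq_le0 : forall x, qualities x ->
    derive_in qualities (derive_in qualities V) x <= 0;
  vCP_t_gt0 : forall x t, qualities x -> types t ->
    0 < dt (virtual F f CP) x t;
  vCP_qq_gt0 : forall x t, qualities x -> types t ->
    0 < dq (dq (virtual F f CP)) x t;
  vCP_qt_ge0 : forall x t, qualities x -> types t ->
    0 <= dt (dq (virtual F f CP)) x t;
  vCI_t_gt0 : forall x t, 0 < x -> types t ->
    0 < dt (virtual F f CI) x t;
  vCI_qq_gt0 : forall x t, qualities x -> types t ->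
    0 < dq (dq (virtual F f CI)) x t;
  vCI_qt_ge0 : forall x t, qualities x -> types t ->
    0 <= dt (dq (virtual F f CI)) x t;
  V_at_0 : forall t, types t ->
    dq (virtual F f CP) 0 t < derive_in qualities V 0;
  V_at_infty : forall t, types t -> exists x0, forall x,
    qualities x -> x0 <= x ->
    derive_in qualities V x
      < dq (virtual F f CP) x t + dq (virtual F f CI) x t }.

(* Mutual independence; taking A i = setT for some of the i gives the product
   rule for every subfamily. *)
Definition independent_RVs (R : realType) (d : measure_display)
    (Omega : measurableType d) (P : probability Omega R) (n : nat)
    (X : 'I_n -> {RV P >-> R}) : Prop :=
  forall A : 'I_n -> set R, (forall i, measurable (A i)) ->
  P [set w | forall i, A i (X i w)]
    = (\prod_(i < n) fine (P (X i @^-1` A i)))%:E.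

Record type_model (R : realType) (d : measure_display)
    (Omega : measurableType d) (P : probability Omega R) (n : nat)
    (X : 'I_n -> {RV P >-> R}) (F f : R -> R) : Prop := {
  types_in : forall i w, types (X i w);
  types_indep : independent_RVs X;
  types_cdf : forall i t, cdf (X i) t = (F t)%:E;
  types_density : forall t, types t ->
    F t = (\int[lebesgue_measure]_(u in `[0, t]) f u)%R;
  density_gt0 : forall t, types t -> 0 < f t;
  density_diff : forall t, types t -> derivable_in types f t }.

(* A bid is a (quality, message) pair. Scores live in \bar R because s may take
   the value -oo, see [score_rule]. *)
Definition score (R : realType) (s : R -> \bar R) (b : R * R) : \bar R :=
  (s b.1 - b.2%:E)%E.

Definition winners (R : realType) (n : nat) (s : R -> \bar R)
    (b : 'I_n -> R * R) : {set 'I_n} :=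
  [set i | [forall j, (score s (b j) <= score s (b i))%E]]%SET.

Definition share (R : realType) (n : nat) (s : R -> \bar R)
    (b : 'I_n -> R * R) (i : 'I_n) : R :=
  if i \in winners s b then #|winners s b|%:R^-1 else 0.

Definition profit (R : realType) (n : nat) (CP CI : R -> R -> R)
    (s : R -> \bar R) (b : 'I_n -> R * R) (i : 'I_n) (t : R) : R :=
  (b i).2 * share s b i - CP (b i).1 t * share s b i - CI (b i).1 t.

(* Since the types are independent, what firm i knows (its own type t) does not
   affect the law of the others' types: the interim expectation is the plain
   expectation with firm i's own type and bid frozen at t and b. *)
Definition interim_profit (R : realType) (d : measure_display)
    (Omega : measurableType d) (P : probability Omega R) (n : nat)
    (X : 'I_n -> {RV P >-> R}) (CP CI : R -> R -> R) (s : R -> \bar R)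
    (sigma : 'I_n -> R -> R * R) (i : 'I_n) (t : R) (b : R * R) : \bar R :=
  ('E_P[fun w => profit CP CI s
                   (fun j => if j == i then b else sigma j (X j w)) i t])%E.

Definition feasible (R : realType) (b : R * R) : Prop := 0 <= b.1 /\ 0 <= b.2.

Definition bayes_nash (R : realType) (d : measure_display)
    (Omega : measurableType d) (P : probability Omega R) (n : nat)
    (X : 'I_n -> {RV P >-> R}) (CP CI : R -> R -> R) (s : R -> \bar R)
    (Theta : set R) (sigma : 'I_n -> R -> R * R) : Prop :=
  forall i t, Theta t ->
    feasible (sigma i t) /\
    forall b, feasible b ->
      (interim_profit X CP CI s sigma i t b
        <= interim_profit X CP CI s sigma i t (sigma i t))%E.

Record quality_function (R : realType) (q : R -> R) : Prop := {
  quality_ge0 : forall t, types t -> 0 <= q t;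
  quality_decr : forall t u, types t -> types u -> t < u -> q u < q t }.

(* The inverse theta(x) of a strictly decreasing q: it is the inverse on the
   range of q, and is extended monotonically to all qualities (firms may deviate
   to any of them): 0 above q(0), 1 below q(1), the jump point in a gap of the
   range if q is discontinuous. *)
Definition inverse (R : realType) (q : R -> R) (x : R) : R :=
  sup [set t | types t /\ (t = 0 \/ x <= q t)].

(* s'(x) = C^P_q + C^I_q / (1 - F(theta(x)))^(n-1).  The right-hand side is
   meaningful when theta(x) < 1, that is on an open half-line ]a, +oo[ with
   a >= 0 (and a = 0 if q is continuous with q(1) = 0).  At its end point a,
   s is the limit from the right.  On [0, a[, where the right-hand side is
   infinite, s = -oo: qualities below those the rule is designed to induce
   cannot win. *)
Record score_rule (R : realType) (n : nat) (F : R -> R) (CP CI : R -> R -> R)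
    (q : R -> R) (s : R -> \bar R) : Prop := {
  score_fin : forall x, 0 <= x -> inverse q x < 1 -> s x \is a fin_num;
  score_derive : forall x, 0 <= x -> inverse q x < 1 ->
    is_derive x 1 (fine \o s)
      (dq CP x (inverse q x)
       + dq CI x (inverse q x) / (1 - F (inverse q x)) ^+ n.-1);
  score_rcont : forall x, 0 <= x -> inverse q x = 1 ->
    s y @[y --> x^'+] --> s x;
  score_below : forall x y, 0 <= x -> x < y -> inverse q y = 1 ->
    s x = -oo%E }.

(* IR(a, b), for a <= b. *)
Definition info_rent (R : realType) (n : nat) (F : R -> R)
    (CP CI : R -> R -> R) (q : R -> R) (a b : R) : R :=
  (\int[lebesgue_measure]_(u in `[a, b])
     (dt CP (q u) u * (1 - F u) ^+ n.-1 + dt CI (q u) u))%R.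

(* At t = 1 the fraction is 0 / 0 if q(1) = 0, read as 0. *)
Definition price (R : realType) (n : nat) (F : R -> R) (CP CI : R -> R -> R)
    (q : R -> R) (t : R) : R :=
  CP (q t) t
  + (CI (q t) t + info_rent n F CP CI q t 1) / (1 - F t) ^+ n.-1.

(* The types for which the prescribed price is a real number: all of [0, 1] if
   q(1) = 0, and [0, 1[ if q(1) > 0, in which case p(1) = C^I(q(1), 1) / 0 is
   infinite. *)
Definition priced_types (R : realType) (q : R -> R) : set R :=
  [set t | types t /\ (t < 1 \/ q 1 = 0)].

(* Main.v *)
(* Let G = (1 - F)^(n-1), and let theta be the inverse of q. A firm of type t that
   chooses quality x and the price giving it the equilibrium score S(tau) of type
   tau wins with probability G(tau); call its profit pi(x, tau; t). The prices are
   such that pi(q(tau), tau; tau) = IR(tau, 1). As a function of x, the slope of pi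
   is G(tau) s'(x) - G(tau) C^P_q(x, t) - C^I_q(x, t). If t <= tau and x >= q(tau),
   then G(tau) <= G(theta(x)), so the slope is at most c_q(x, theta(x)) - c_q(x, t)
   with c = G(tau) C^P + C^I, and is nonpositive once theta(x) < t. Integrating
   c_{q theta} over the region below the graph of q, one gets
     pi(x, tau; t) <= IR(tau, 1) + int_t^tau c_theta(min(q(u), x), u) du,
   which is at most IR(t, 1) since G(tau) <= G(u) for u <= tau. The case t >= tau is
   symmetric, with max for min, so imitating t itself is optimal. The strict decrease
   of S follows from the same inequality with x = q(t), and all other scores
   are handled by a limit. *)
Require Import Defs.
From mathcomp Require Import all_boot all_order all_algebra.
From mathcomp Require Import all_classical all_reals all_analysis.
From mathcomp Require Import measurable_realfun ring lra.
Import Order.TTheory GRing.Theory Num.Theory.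
Import numFieldNormedType.Exports.
Local Open Scope classical_set_scope.
Local Open Scope ring_scope.

(** * Derivatives relative to a domain, as limits of difference quotients *)

Section Derivatives.
Set Implicit Arguments.
Unset Strict Implicit.
Context {R : realType}.
Implicit Types (D : set R) (f g k : R -> R) (x l : R).

Lemma derive_inP D f x : derivable_in D f x ->
  forall e, 0 < e -> exists2 del, 0 < del & forall y, D y -> y != x ->
    `|y - x| < del -> `|diff_quot f x y - derive_in D f x| < e.
Proof.
move=> df e e0.
have /cvgrPdist_lt/(_ e e0) : diff_quot f x @ within D x^' --> derive_in D f x.
  exact: df.
rewrite near_withinE => /nbhs_ballP[/= del del0 H].
exists del => // y Dy yx yd; rewrite distrC; apply: H => //.
by rewrite /ball /= distrC.
Qed.

Lemma derive_in_cvg D f x : derivable_in D f x ->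
  f @ within D (nbhs x) --> f x.
Proof.
move=> df; have [del del0 H] := derive_inP df ltr01.
set l := derive_in D f x in H.
apply/cvgrPdist_lt => e e0; rewrite near_withinE; apply/nbhs_ballP.
have l1 : 0 < `|l| + 1 by rewrite ltr_wpDl.
(* Within [del] of [x] the difference quotient is bounded by [|l| + 1], so this radius keeps the
   increment of [f] below [e]. *)
exists (Num.min del (e / (`|l| + 1))) => /=.
  by rewrite lt_min del0 divr_gt0.
move=> y; rewrite /ball /= lt_min distrC => /andP[yd ye] Dy.
have [->|yx] := eqVneq y x; first by rewrite subrr normr0.
have yx0 : y - x != 0 by rewrite subr_eq0.
rewrite distrC -(divfK yx0 (f y - f x)) normrM -/(diff_quot f x y).
have {}H := H y Dy yx yd.
have Q1 : `|diff_quot f x y| < `|l| + 1.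
  rewrite -(subrK l (diff_quot f x y)); apply: le_lt_trans (ler_normD _ _) _.
  by rewrite addrC ltrD2l.
rewrite ltr_pdivlMr// in ye.
apply: le_lt_trans ye; rewrite mulrC ler_wpM2l//; exact: ltW.
Qed.

Lemma is_derive_near f x l :
  (forall e, 0 < e -> exists2 del, 0 < del & forall y, y != x ->
    `|y - x| < del -> `|diff_quot f x y - l| < e) ->
  is_derive x 1 f l.
Proof.
move=> H.
have C : (fun h : R => h^-1 *: (f (h *: 1 + x) - f x)) @ 0^' --> l.
  apply/cvgrPdist_lt => e /H[del del0 {}H].
  apply/nbhs_ballP; exists del => // h.
  rewrite /ball /= sub0r normrN => hd h0.
  have hx : h + x != x by rewrite -subr_eq0 addrK.
  have := H _ hx; rewrite /diff_quot addrK distrC => /(_ hd).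
  by rewrite [h *: 1]mulr1 mulrC.
apply: DeriveDef; first exact: (cvgP _ C).
exact: cvg_lim C.
Qed.

Lemma is_derive_diff_quot f x l : is_derive x 1 f l ->
  forall e, 0 < e -> exists2 del, 0 < del & forall y, y != x ->
    `|y - x| < del -> `|diff_quot f x y - l| < e.
Proof.
move=> [df <-] e e0.
have /cvgrPdist_lt/(_ e e0) :
  (fun h : R => h^-1 *: (f (h *: 1 + x) - f x)) @ 0^' --> 'D_1 f x by exact: df.
move=> /nbhs_ballP[/= del del0 H]; exists del => // y yx yd.
have yx0 : y - x != 0 by rewrite subr_eq0.
have := H (y - x); rewrite /ball /= sub0r normrN => /(_ yd yx0).
by rewrite [(y - x) *: 1]mulr1 subrK [_ *: _]mulrC distrC.
Qed.

Lemma derive_in_is_derive D f x : nbhs x D -> derivable_in D f x ->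
  is_derive x 1 f (derive_in D f x).
Proof.
move=> /nbhs_ballP[r /= r0 xD] df; apply: is_derive_near => e e0.
have [del del0 H] := derive_inP df e0.
exists (Num.min r del) => [|y yx]; first by rewrite lt_min r0.
rewrite lt_min => /andP[yr yd]; apply: H => //.
by apply: xD; rewrite /ball /= distrC.
Qed.

Lemma derive_in_within D f a b :
  `[a, b] `<=` D -> (forall x, a <= x <= b -> derivable_in D f x) ->
  {within `[a, b], continuous f}.
Proof.
move=> abD df; apply/subspace_continuousP => x /=; rewrite in_itv /= => xab.
apply: cvg_trans (derive_in_cvg (df x xab)).
by apply: cvg_app; exact: within_subset.
Qed.

End Derivatives.

(** * Monotonicity from one-sided differentiable supports *)

Section Monotonicity.
Set Implicit Arguments.
Unset Strict Implicit.
Context {R : realType}.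
Implicit Types (D : set R) (f g k : R -> R) (x l a b : R).

Lemma derive_in_is_derive_oo D f a b x :
  `[a, b] `<=` D -> (forall y, a <= y <= b -> derivable_in D f y) ->
  a < x < b -> is_derive x 1 f (derive_in D f x).
Proof.
move=> abD df /andP[ax xb]; apply: derive_in_is_derive; last first.
  by apply: df; rewrite !ltW.
have : nbhs x `]a, b[%classic by apply: near_in_itvoo; rewrite in_itv /= ax.
by apply: filterS => y /subset_itv_oo_cc /abD.
Qed.

Lemma derive_in_ge0_le D f a b : a <= b -> `[a, b] `<=` D ->
  (forall x, a <= x <= b -> derivable_in D f x) ->
  (forall x, a < x < b -> 0 <= derive_in D f x) -> f a <= f b.
Proof.
rewrite le_eqVlt => /predU1P[-> //|ab] abD df df0.
have [|c cab E] := @MVT R f (derive_in D f) a b ab _ (derive_in_within abD df).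
  move=> x; rewrite in_itv /=; exact: derive_in_is_derive_oo df.
rewrite -subr_ge0 E mulr_ge0//; last by rewrite subr_ge0 ltW.
by apply: df0; rewrite in_itv in cab.
Qed.

(* A Dini-type criterion: [g] need only be semicontinuous, because it is applied
   to a differentiable function plus a monotone, possibly discontinuous one. *)
Lemma support_le g a b : a <= b ->
  (forall c, a <= c < b -> exists k l, [/\ is_derive c 1 k l, 0 <= l &
     forall x, c < x <= b -> k x - k c <= g x - g c]) ->
  (forall c, a < c <= b -> forall e, 0 < e -> exists2 del, 0 < del &
     forall x, a <= x -> c - del < x < c -> g x <= g c + e) ->
  g a <= g b.
Proof.
move=> ab Hder Hsc; apply/ler_addgt0Pr => e0 e00.
(* A slope whose total effect over [[a, b]] is at most [e0]; the [+ 1] in the witness covers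
   [a = b]. *)
have [e e_gt0 He] : exists2 e, 0 < e & e * (b - a) <= e0.
  exists (e0 / (b - a + 1)); first by rewrite divr_gt0// ltr_wpDl// subr_ge0.
  rewrite mulrAC ler_pdivrMr ?ler_wpM2l ?ltW//; first by rewrite ltrDl.
  by rewrite ltr_wpDl// subr_ge0.
(* Points reached with an average fall of slope at most [e]. Semicontinuity puts the supremum [c]
   into [A], and [c < b] is impossible because the support at [c] puts a point beyond [c] into
   [A]. *)
pose A := [set y | a <= y <= b /\ g a <= g y + e * (y - a)].
have Aa : A a by rewrite /A /= lexx ab subrr mulr0 addr0.
have supA : has_sup A by split; [exists a|exists b => y [/andP[]]].
set c := sup A.
have ac : a <= c by apply: ub_le_sup => //; case: supA.
have cb : c <= b by apply: ge_sup => [|y [/andP[]]//]; exists a.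
have Ac : g a <= g c + e * (c - a).
  move: ac; rewrite le_eqVlt => /predU1P[<-|ac]; first by case: Aa.
  apply/ler_addgt0Pr => e' e'0.
  have [|del del0 H] := Hsc c _ e' e'0; first by rewrite ac.
  have [y Ay cy] := sup_adherent del0 supA.
  have yc : y <= c by apply: ub_le_sup => //; case: supA.
  case: Ay => /andP[ay yb] gy.
  move: yc; rewrite le_eqVlt => /predU1P[<-|yc].
    by apply: le_trans gy _; rewrite lerDl ltW.
  apply: (le_trans gy); rewrite addrAC lerD//; first by apply: H; rewrite ?cy.
  by rewrite (ler_wpM2l (ltW e_gt0))// lerB// ltW.
move: cb; rewrite le_eqVlt => /predU1P[cb|cb].
  by rewrite -cb; apply: (le_trans Ac); rewrite lerD2l {1}cb.
have [|k [l [dk l0 H]]] := Hder c; first by rewrite ac.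
have [del del0 {}dk] := is_derive_diff_quot dk e_gt0.
pose x := Num.min b (c + del / 2).
have cx : c < x by rewrite lt_min cb ltrDl divr_gt0.
have xb : x <= b by rewrite ge_min lexx.
have xd : `|x - c| < del.
  rewrite gtr0_norm ?subr_gt0// ltrBlDl; 
  have xc2 : x <= c + del / 2 by rewrite ge_min lexx orbT.
  by apply: le_lt_trans xc2 _; rewrite ltrD2l ltr_pdivrMr// ltr_pMr// ltr1n.
have /andP[+ _] : -e < diff_quot k c x - l < e.
  by rewrite -ltr_norml; apply: dk => //; rewrite gt_eqF.
rewrite ltrBrDl => kx.
have {}kx : - e < diff_quot k c x by apply: le_lt_trans kx; rewrite lerDr.
rewrite /diff_quot ltr_pdivlMr ?subr_gt0// in kx.
have := H x; rewrite cx xb => /(_ isT) Hx.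
suff Ax : A x by have := ub_le_sup (proj2 supA) Ax; rewrite leNgt cx.
split; first by rewrite xb (le_trans ac) ?ltW.
move: Ac kx Hx; set ga := g a; set gx := g x; set gc := g c; set kk := k x - k c.
lra.
Qed.

(** Mirror image of [support_le] under [x -> - x]: supports act to the left of [c], semicontinuity
    to its right. *)
Lemma support_ge g a b : a <= b ->
  (forall c, a < c <= b -> exists k l, [/\ is_derive c 1 k l, l <= 0 &
     forall x, a <= x < c -> g c - g x <= k c - k x]) ->
  (forall c, a <= c < b -> forall e, 0 < e -> exists2 del, 0 < del &
     forall x, x <= b -> c < x < c + del -> g x <= g c + e) ->
  g b <= g a.
Proof.
move=> ab Hder Hsc.
rewrite -(opprK a) -[in g b](opprK b).
apply: (@support_le (g \o -%R)); first by rewrite lerN2.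
- move=> c /andP[bc ca].
  have [|k [l [dk l0 H]]] := Hder (- c); first by rewrite ltrNr ca lerNl bc.
  exists (k \o -%R), (- l); split; rewrite ?oppr_ge0//.
    apply: is_derive_near => e e0.
    have [del del0 {}dk] := is_derive_diff_quot dk e0.
    exists del => // y yc yd.
    have := dk (- y); rewrite eqr_opp yc -normrN opprB opprK addrC => /(_ isT yd).
    rewrite -normrN /diff_quot /=; congr (`|_| < _).
    by rewrite -(opprD y) invrN mulrN opprD !opprK.
  move=> x /andP[cx xa]; have := H (- x); rewrite lerNr xa ltrN2 cx => /(_ isT).
  by rewrite /=; lra.
- move=> c /andP[bc ca] e e0.
  have [|del del0 H] := Hsc (- c) _ e e0; first by rewrite lerNr ca ltrNl bc.
  exists del => // x bx /andP[cx xc]; apply: H; first by rewrite lerNl.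
  by rewrite ltrN2 xc /= ltrNl opprD opprK.
Qed.

End Monotonicity.

(** * Integrability along monotone quality profiles *)

Section MonotoneProfiles.
Set Implicit Arguments.
Unset Strict Implicit.
Context {R : realType}.
Implicit Types (rho : R -> R) (t u x y : R).
Local Notation mu := (@lebesgue_measure R).

(** This class contains the quality functions and the nonnegative constants and is stable under
    truncation at a nonnegative level: these are the qualities along which marginal costs get
    integrated. *)
Definition profile rho := (forall u, types u -> 0 <= rho u) /\
  (forall t u, types t -> types u -> t <= u -> rho u <= rho t).

Lemma profile_cst x : 0 <= x -> profile (fun=> x).
Proof. by []. Qed.

Lemma profile_min rho x : 0 <= x -> profile rho ->
  profile (fun u => Num.min (rho u) x).
Proof.
move=> x0 [r0 rm]; split=> [u tu|t u tt tu tlu].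
  by rewrite le_min r0.
by rewrite le_min !ge_min rm//= lexx orbT.
Qed.

Lemma profile_max rho x : 0 <= x -> profile rho ->
  profile (fun u => Num.max (rho u) x).
Proof.
move=> x0 [r0 rm]; split=> [u tu|t u tt tu tlu].
  by rewrite le_max x0 orbT.
by rewrite ge_max !le_max rm//= lexx orbT.
Qed.

Lemma types0 : types (0 : R). Proof. by rewrite /types /= lexx ler01. Qed.
Lemma types1 : types (1 : R). Proof. by rewrite /types /= lexx ler01. Qed.

Lemma types_between t u x : types t -> types u -> t <= x <= u -> types x.
Proof.
rewrite /types /= => /andP[t0 _] /andP[_ u1] /andP[tx xu].
by rewrite (le_trans t0 tx) (le_trans xu u1).
Qed.

Lemma types_itv t u : types t -> types u -> `[t, u] `<=` @types R.
Proof. by move=> Tt Tu x; rewrite /= in_itv /=; exact: types_between. Qed.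

Section Integrability.
Variable K : R -> R -> R.
Hypothesis K_cont : forall x, 0 <= x -> {within `[0, 1], continuous (K x)}.
Hypothesis K_contl : forall x u, 0 <= x -> types u ->
  K^~ u @ within qualities (nbhs x) --> K x u.

(** [K] is only separately continuous, so [rho u] is rounded down to multiples of [1 / (k + 1)]. By
    monotonicity each level set is an interval, on which [K] at a fixed quality is continuous in
    [u]; the rounded qualities converge to [rho u]. *)
Lemma profile_measurable rho : profile rho ->
  measurable_fun `[0 : R, 1] (fun u => K (rho u) u).
Proof.
move=> [r0 rm].
pose N k u := Num.truncn (rho u * k.+1%:R).
pose h k u := K ((N k u)%:R / k.+1%:R) u.
apply: (@measurable_fun_cvg _ _ _ _ h).
- move=> k; pose A m := `[0 : R, 1] `&` [set u | N k u = m].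
  have E : `[0 : R, 1]%classic = \bigcup_m A m.
    apply/seteqP; split=> [u u01|u [m _ []//]].
    by exists (N k u).
  have mA m : measurable (A m).
    apply: is_interval_measurable => u v; rewrite /A /= !in_itv /=.
    move=> [Tu Nu] [Tv Nv] w uwv.
    have Tw : types w by exact: types_between Tu Tv uwv.
    case/andP: uwv => uw wv.
    split; first exact: Tw.
    apply/eqP; rewrite eqn_leq -{1}Nu -Nv.
    by apply/andP; split; apply: le_truncn; apply: ler_wpM2r;
      rewrite ?ler0n//; exact: rm.
  rewrite E; apply/measurable_fun_bigcup => // m.
  apply: (@eq_measurable_fun _ _ _ _ _ (K (m%:R / k.+1%:R))).
    by move=> u; rewrite inE /= => -[_ Nu]; rewrite /h Nu.
  apply: (@measurable_funS _ _ _ _ `[0 : R, 1]) => //; first by move=> u [].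
  apply: subspace_continuous_measurable_fun => //.
  by apply: K_cont; rewrite divr_ge0.
- move=> u; rewrite /= in_itv /= => Tu.
  have ru0 := r0 u Tu.
  pose xk k : R := (N k u)%:R / k.+1%:R.
  have xk0 k : 0 <= xk k by rewrite divr_ge0.
  have xkE k : rho u - harmonic k <= xk k <= rho u.
    have := @truncn_itv R (rho u * k.+1%:R).
    rewrite mulr_ge0// => /(_ isT) /andP[lo hi].
    rewrite /xk /harmonic /= ler_pdivrMr// lo andbT.
    rewrite ler_pdivlMr// mulrBl mulVf ?pnatr_eq0//.
    by rewrite lerBlDr natr1 ltW.
  have xkr : xk @ \oo --> rho u.
    apply: (@squeeze_cvgr _ _ _ _ (fun k => rho u - harmonic k) (cst (rho u))).
    - by near=> k; exact: xkE.
    - rewrite -[X in _ --> X]subr0; apply: cvgB; first exact: cvg_cst.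
      exact: cvg_harmonic.
    - exact: cvg_cst.
  (* The rounded qualities stay nonnegative, so continuity relative to [qualities] suffices, even
     where [rho u = 0]. *)
  apply: (@cvg_comp _ _ _ xk (K^~ u) _ (within qualities (nbhs (rho u)))).
    move=> B HB.
    have HN : \forall k \near \oo, qualities (xk k) -> B (xk k) by exact: (xkr _ HB).
    change (\forall k \near \oo, B (xk k)).
    by apply: filterS HN => k /(_ (xk0 k)).
  exact: K_contl.
Unshelve. all: by end_near.
Qed.

Hypothesis K_homo : forall x y u, 0 <= x -> x <= y -> types u ->
  K x u <= K y u.

(** The integrand lies between [K 0 u] and [K (rho 0) u], which are continuous in [u]; the sum of
    their absolute values dominates it. *)
Lemma profile_integrable rho : profile rho ->
  mu.-integrable `[0 : R, 1] (EFin \o (fun u => K (rho u) u)).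
Proof.
move=> prho; have [r0 rm] := prho.
have K_int x : 0 <= x -> mu.-integrable `[0 : R, 1] (EFin \o K x).
  move=> x0; apply: continuous_compact_integrable; last exact: K_cont.
  exact: segment_compact.
have i0 := K_int 0 (lexx 0).
have i1 := K_int (rho 0) (r0 _ types0).
apply: (@le_integrable _ _ _ mu `[0 : R, 1] _ _
  (fun u => (`|(K 0%R u)%:E| + `|(K (rho 0%R) u)%:E|)%E)) => //.
- by apply/measurable_EFinP; exact: profile_measurable.
- move=> u; rewrite /= in_itv /= => Tu; rewrite lee_fin [leRHS]ger0_norm ?addr_ge0//.
  have lo := K_homo (lexx 0) (r0 u Tu) Tu.
  have [u0 u1] := andP Tu.
  have hi := K_homo (r0 u Tu) (rm _ _ types0 Tu u0) Tu.
  rewrite ler_norml; apply/andP; split.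
    rewrite lerNl; apply: le_trans (_ : `|K 0 u| <= _); last by rewrite lerDl.
    by rewrite -normrN; apply: le_trans (ler_norm _); rewrite lerN2.
  apply: le_trans (_ : `|K (rho 0) u| <= _); last by rewrite lerDr.
  by apply: le_trans hi _; exact: ler_norm.
- by apply: integrableD => //; exact: integrable_abse.
Qed.

End Integrability.
End MonotoneProfiles.

(** * Monotonicity and integration of marginal costs *)

Section Costs.
Set Implicit Arguments.
Unset Strict Implicit.
Context {R : realType}.
Implicit Types (rho : R -> R) (t u x y : R).
Local Notation mu := (@lebesgue_measure R).

Lemma qualities_itv x y : 0 <= x -> `[x, y] `<=` @qualities R.
Proof.
by move=> x0 z; rewrite /= in_itv /= => /andP[+ _]; exact: le_trans.
Qed.

Lemma nbhs_qualities x : 0 < x -> nbhs x (@qualities R).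
Proof.
move=> x0; have : nbhs x `]0 : R, +oo[%classic.
  by apply: near_in_itvoy; rewrite in_itv /= x0.
by apply: filterS => y; rewrite /= in_itv /= andbT => /ltW.
Qed.

(** Supplies a type at which two difference quotients are both close to their limits, also at the
    end points of [[0, 1]]. *)
Lemma types_near u : types u -> forall e, 0 < e ->
  exists v, [/\ types v, v != u & `|v - u| < e].
Proof.
move=> /andP[u0 u1] e e0.
(* At most [1/2], so the step fits to the right of [u] if [u <= 1/2] and to the left otherwise. *)
pose e' := Num.min e 1 / 2.
have e'0 : 0 < e' by rewrite divr_gt0// lt_min e0 ltr01.
have e'e : e' < e.
  rewrite /e' ltr_pdivrMr// gt_min; apply/orP; left.
  by rewrite ltr_pMr// ltr1n.
have e'1 : e' <= 2^-1.
  by rewrite /e' ler_pdivrMr// mulVf// ge_min lexx orbT.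
have [u2|u2] := leP u 2^-1.
  exists (u + e'); split.
  - rewrite /types /= addr_ge0 ?(ltW e'0)//=; lra.
  - by rewrite -subr_eq0 addrAC subrr add0r gt_eqF.
  - by rewrite addrAC subrr add0r gtr0_norm.
exists (u - e'); split.
- rewrite /types /=; lra.
- by rewrite -subr_eq0 addrAC subrr add0r oppr_eq0 gt_eqF.
- by rewrite addrAC subrr add0r normrN gtr0_norm.
Qed.

Lemma FTC_within (D : set R) (f F : R -> R) t u : `[t, u] `<=` D ->
  t <= u -> {within `[t, u], continuous f} ->
  (forall x, t <= x <= u -> derivable_in D F x) ->
  (forall x, t < x < u -> derive_in D F x = f x) ->
  (\int[mu]_(x in `[t, u]) f x = F u - F t)%R.
Proof.
move=> tuD; rewrite le_eqVlt => /predU1P[<-|tu] cf dF Ff.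
  by rewrite set_itv1 Rintegral_set1 subrr.
rewrite /Rintegral (@continuous_FTC2 R f F)//.
- split.
  + move=> x; rewrite in_itv /= => txu.
    exact: (@ex_derive _ _ _ _ _ _ _ (derive_in_is_derive_oo tuD dF txu)).
  + by have /(continuous_within_itvP _ tu)[] := derive_in_within tuD dF.
  + by have /(continuous_within_itvP _ tu)[] := derive_in_within tuD dF.
- move=> x; rewrite in_itv /= => txu; rewrite derive1E.
  rewrite (@derive_val _ _ _ _ _ _ _ (derive_in_is_derive_oo tuD dF txu)).
  exact: Ff.
Qed.

Variable C : R -> R -> R.
Hypothesis C_diff : differentiable_cost C.
Hypothesis C_qt : forall x t, 0 < x -> types t -> 0 <= dt (dq C) x t.

Lemma dq_homo x t u : 0 < x -> types t -> types u -> t <= u ->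
  dq C x t <= dq C x u.
Proof.
move=> x0 Tt Tu tu.
apply: (@derive_in_ge0_le _ types (dq C x)) => //; first exact: types_itv.
- move=> s tsu; apply: cost_qt => //; first exact: ltW.
  exact: types_between tsu.
- move=> s /andP[ts su]; apply: C_qt => //.
  by apply: types_between Tt Tu _; rewrite !ltW.
Qed.

Lemma is_derive_dq x t : 0 < x -> types t ->
  is_derive x 1 (C^~ t) (dq C x t).
Proof.
move=> x0 Tt; apply: (derive_in_is_derive (nbhs_qualities x0)).
by apply: cost_q => //; exact: ltW.
Qed.

(** Mean value theorem in the quality, with [C_q] nondecreasing in the type. Only interior qualities
    enter, so [x = 0] is allowed although [C_qt] concerns positive qualities. *)
Lemma cost_increment_homo x y t u : 0 <= x -> x <= y ->
  types t -> types u -> t <= u -> C x u - C x t <= C y u - C y t.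
Proof.
move=> x0; rewrite le_eqVlt => /predU1P[-> //|xy] Tt Tu tu.
have cont s : types s -> {within `[x, y], continuous C^~ s}.
  move=> Ts; apply: (@derive_in_within _ qualities); first exact: qualities_itv.
  move=> z /andP[xz _]; apply: (cost_q C_diff) => //.
  exact: le_trans x0 xz.
have [z|c cxy E] := @MVT R (C^~ u - C^~ t) (fun z => dq C z u - dq C z t) _ _ xy
    _ (fun z => continuousB (cont u Tu z) (cont t Tt z)).
  rewrite in_itv /= => /andP[xz _].
  by apply: is_deriveB; apply: is_derive_dq => //; exact: le_lt_trans x0 xz.
rewrite -subr_ge0 [X in 0 <= X](_ : _ = (C^~ u - C^~ t) y - (C^~ u - C^~ t) x)//.
rewrite E mulr_ge0 ?subr_ge0 ?(ltW xy)//.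
apply: dq_homo => //; move: cxy; rewrite in_itv /= => /andP[xc _].
exact: le_lt_trans x0 xc.
Qed.

(** Difference quotients in the type are monotone in the quality by [cost_increment_homo], and this
    passes to their limit; it replaces an appeal to the symmetry of mixed derivatives. *)
Lemma dt_homo x y u : 0 <= x -> x <= y -> types u -> dt C x u <= dt C y u.
Proof.
move=> x0 xy Tu; rewrite leNgt; apply/negP => yx.
pose e := (dt C x u - dt C y u) / 2.
have e0 : 0 < e by rewrite divr_gt0// subr_gt0.
have y0 : 0 <= y by exact: le_trans xy.
have [d1 d10 H1] := derive_inP (cost_t C_diff x0 Tu) e0.
have [d2 d20 H2] := derive_inP (cost_t C_diff y0 Tu) e0.
have d12 : 0 < Num.min d1 d2 by rewrite lt_min d10.
have [v [Tv vu]] := types_near Tu d12.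
rewrite lt_min => /andP[vd1 vd2].
have := H1 v Tv vu vd1; have := H2 v Tv vu vd2.
rewrite -/(dt C y u) -/(dt C x u) !ltr_norml => /andP[_ h2] /andP[h1 _].
suff le12 : diff_quot (C x) u v <= diff_quot (C y) u v by rewrite /e in h1 h2; lra.
rewrite /diff_quot; case: (ltgtP v u) vu => // uv _.
  rewrite -[v - u]opprB invrN !mulrN -!mulNr !opprB ler_pM2r.
    by apply: cost_increment_homo => //; exact: ltW.
  by rewrite invr_gt0 subr_gt0.
rewrite ler_pM2r; last by rewrite invr_gt0 subr_gt0.
by apply: cost_increment_homo => //; exact: ltW.
Qed.

Lemma dt_continuous x : 0 <= x -> {within `[0, 1], continuous (dt C x)}.
Proof.
move=> x0; apply: (@derive_in_within _ types).
  exact: types_itv types0 types1.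
by move=> u Tu; exact: (cost_tt C_diff).
Qed.

Lemma profile_dt_integrable rho : profile rho ->
  mu.-integrable `[0 : R, 1] (EFin \o (fun u => dt C (rho u) u)).
Proof.
apply: profile_integrable; first exact: dt_continuous.
- move=> x u x0 Tu; apply: derive_in_cvg.
  by apply: (cost_tq C_diff).
- exact: dt_homo.
Qed.

Lemma integral_dt x t u : 0 <= x -> types t -> types u -> t <= u ->
  (\int[mu]_(s in `[t, u]) dt C x s = C x u - C x t)%R.
Proof.
move=> x0 Tt Tu tu; apply: (@FTC_within types) => //.
- exact: types_itv.
- by apply: continuous_subspaceW (dt_continuous x0); exact: types_itv.
- by move=> s tsu; apply: (cost_t C_diff) => //; exact: types_between tsu.
Qed.

End Costs.

(** * Regularity of the type distribution *)

Section Distribution.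
Set Implicit Arguments.
Unset Strict Implicit.
Context {R : realType}.
Implicit Types (t u x y : R).
Local Notation mu := (@lebesgue_measure R).
Variables F f : R -> R.
Hypothesis F_density : forall t, types t ->
  F t = (\int[mu]_(u in `[0, t]) f u)%R.
Hypothesis f_gt0 : forall t, types t -> 0 < f t.
Hypothesis f_diff : forall t, types t -> derivable_in types f t.

Let f_cont : {within `[0, 1], continuous f}.
Proof.
by apply: (derive_in_within (types_itv types0 types1)) => t; exact: f_diff.
Qed.

Let f_int t u : types t -> types u ->
  mu.-integrable `[t, u] (EFin \o f).
Proof.
move=> Tt Tu; apply: continuous_compact_integrable; first exact: segment_compact.
by apply: continuous_subspaceW f_cont; exact: types_itv.
Qed.

Lemma cdf_at0 : F 0 = 0.
Proof. by rewrite (F_density types0) set_itv1 Rintegral_set1. Qed.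

Lemma cdf_increment t u : types t -> types u -> t <= u ->
  F u - F t = (\int[mu]_(s in `[t, u]) f s)%R.
Proof.
move=> Tt Tu tu; have [t0 t1] := andP Tt.
rewrite !F_density// Rintegral_itvB ?bnd_simp//; last exact: f_int types0 Tu.
apply: Rintegral_itv_obnd_cbnd; apply: integrableS (f_int Tt Tu) => //.
by move=> s; rewrite /= !in_itv /= => /andP[/ltW -> ->].
Qed.

Lemma Rintegral_itv_cst t u r : t <= u ->
  (\int[mu]_(s in `[t, u]) r = r * (u - t))%R.
Proof.
rewrite le_eqVlt => /predU1P[<-|tu].
  by rewrite set_itv1 Rintegral_set1 subrr mulr0.
by rewrite Rintegral_cst//= lebesgue_measure_itv/= lte_fin tu.
Qed.

Lemma integrable_itv_cst t u r : mu.-integrable `[t, u] (EFin \o (fun=> r)).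
Proof.
apply: continuous_compact_integrable; first exact: segment_compact.
by move=> x; exact: cst_continuous.
Qed.

(** The continuous density has a positive minimum on [[t, u]], which bounds the increment of [F]
    from below. *)
Lemma cdf_lt t u : types t -> types u -> t < u -> F t < F u.
Proof.
move=> Tt Tu tu; rewrite -subr_gt0 cdf_increment// ?(ltW tu)//.
have [c ctu cmin] := @EVT_min R f _ _ (ltW tu)
  (continuous_subspaceW (types_itv Tt Tu) f_cont).
have fc : 0 < f c.
  by apply: f_gt0; move: ctu; rewrite in_itv /=; exact: types_between.
apply: (@lt_le_trans _ _ (f c * (u - t))); first by rewrite mulr_gt0// subr_gt0.
rewrite -Rintegral_itv_cst ?(ltW tu)//; apply: le_Rintegral => //.
- exact: integrable_itv_cst.
- exact: f_int.
Qed.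

Lemma cdf_lipschitz : exists2 M, 0 <= M & forall t u, types t -> types u ->
  t <= u -> F u - F t <= M * (u - t).
Proof.
have [c c01 cmax] := @EVT_max R f _ _ ler01 f_cont.
exists (f c); first by apply/ltW/f_gt0; move: c01; rewrite in_itv.
move=> t u Tt Tu tu; rewrite cdf_increment// -Rintegral_itv_cst//.
apply: le_Rintegral => //.
- exact: f_int.
- exact: integrable_itv_cst.
- move=> x; rewrite /= in_itv /= => xtu; apply: cmax.
  by rewrite in_itv; exact: types_between xtu.
Qed.

Lemma cdf_right_lim t : types t -> t < 1 -> forall e, 0 < e ->
  exists u, [/\ types u, t < u, u < 1 & F u - F t < e].
Proof.
move=> Tt t1 e e0; have [M M0 HM] := cdf_lipschitz; have [t0 _] := andP Tt.
(* At most half of the distance to [1], to stay below [1]; [M + 1] replaces [M], which may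
   vanish. *)
pose r := Num.min (e / (M + 1)) (1 - t) / 2.
have M1 : 0 < M + 1 by rewrite ltr_wpDl.
have r0 : 0 < r by rewrite divr_gt0// lt_min subr_gt0 t1 divr_gt0.
have r1 : r <= (1 - t) / 2 by rewrite ler_pM2r// ge_min lexx orbT.
have re : r <= e / (M + 1) / 2 by rewrite ler_pM2r// ge_min lexx.
have Tu : types (t + r) by rewrite /types /=; lra.
exists (t + r); split => //; [lra|lra|].
have tr : t <= t + r by lra.
apply: (le_lt_trans (HM _ _ Tt Tu tr)).
have -> : t + r - t = r by lra.
apply: (@le_lt_trans _ _ ((M + 1) * r)); first by rewrite ler_pM2r// lerDl.
rewrite mulrC -ltr_pdivlMr//; apply: le_lt_trans re _.
by rewrite ltr_pdivrMr// ltr_pMr ?divr_gt0// ltr1n.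
Qed.

End Distribution.

(** * The generalized inverse of the quality function *)

Section Inverse.
Set Implicit Arguments.
Unset Strict Implicit.
Context {R : realType}.
Implicit Types (t u x y : R).
Variable q : R -> R.
Hypothesis q_qual : quality_function q.

Let Inv x := [set t | types t /\ (t = 0 \/ x <= q t)].

Let Inv0 x : Inv x 0.
Proof. by split; [exact: types0|left]. Qed.

Let Inv_sup x : has_sup (Inv x).
Proof. by split; [exists 0; exact: Inv0|exists 1 => t [/andP[]]]. Qed.

Lemma quality_profile : profile q.
Proof.
split; first exact: (quality_ge0 q_qual).
move=> t u Tt Tu; rewrite le_eqVlt => /predU1P[->//|tu].
by apply/ltW/(quality_decr q_qual).
Qed.

Lemma types_inverse x : types (inverse q x).
Proof.
apply/andP; split; first by apply: ub_le_sup; [exact: (Inv_sup x).2|exact: Inv0].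
by apply: ge_sup => [|t [/andP[]]//]; exact: (Inv_sup x).1.
Qed.

(** With [inverse_gt], this locates [x] relative to the graph of [q] on either side of
    [inverse q x]; nothing is claimed at that type itself, where [q] may jump. *)
Lemma inverse_lt x u : types u -> inverse q x < u -> q u < x.
Proof.
move=> Tu; apply: contraTT; rewrite -!leNgt => xq.
by apply: ub_le_sup; [exact: (Inv_sup x).2|split => //; right].
Qed.

Lemma inverse_gt x u : types u -> u < inverse q x -> x <= q u.
Proof.
move=> Tu; rewrite -subr_gt0 => d0.
have [t [Tt H]] := sup_adherent d0 (Inv_sup x).
rewrite subKr => ut; case: H => [t0|xq].
  by have /andP[] := Tu; rewrite leNgt -t0 ut.
by apply: le_trans xq _; apply: quality_profile.2 => //; exact: ltW.
Qed.

Lemma inverse_homo x y : x <= y -> inverse q y <= inverse q x.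
Proof.
move=> xy; apply: ge_sup; first exact: (Inv_sup y).1.
move=> t [Tt H]; apply: ub_le_sup; first exact: (Inv_sup x).2.
by split => //; case: H => [->|yq]; [left|right; exact: le_trans yq].
Qed.

Lemma inverseK t : types t -> inverse q (q t) = t.
Proof.
move=> Tt; apply/eqP; rewrite eq_le; apply/andP; split; rewrite leNgt.
  apply/negP => tq.
  (* This type above [t] would have quality at least [q t], against strict decrease. *)
  pose u := (t + inverse q (q t)) / 2.
  have tu : t < u by rewrite /u; lra.
  have uq : u < inverse q (q t) by rewrite /u; lra.
  have Tu : types u.
    by apply: types_between Tt (types_inverse (q t)) _; rewrite !ltW.
  have := inverse_gt Tu uq; rewrite leNgt => /negP; apply.
  exact: (quality_decr q_qual).
by apply/negP => /(inverse_lt Tt); rewrite ltxx.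
Qed.

Lemma quality_gt0 t : types t -> t < 1 -> 0 < q t.
Proof.
move=> Tt t1; apply: le_lt_trans (quality_ge0 q_qual types1) _.
exact: (quality_decr q_qual) Tt types1 t1.
Qed.

End Inverse.

(** * Costs with the properties that the envelope argument needs *)

Section RegularCosts.
Set Implicit Arguments.
Unset Strict Implicit.
Context {R : realType}.
Implicit Types (t u x y : R).
Local Notation mu := (@lebesgue_measure R).

(** The derivatives are parameters so that the class is visibly closed under [g C + D] with
    [g >= 0]. It is used for [G(tau) C^P + C^I], the expected cost at a frozen winning
    probability. *)
Record regular_cost (C Cq Ct : R -> R -> R) : Prop := {
  regular_q : forall x t, 0 < x -> types t -> is_derive x 1 (C^~ t) (Cq x t);
  regular_qt : forall x t u, 0 < x -> types t -> types u -> t <= u ->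
    Cq x t <= Cq x u;
  regular_tq : forall x y u, 0 <= x -> x <= y -> types u -> Ct x u <= Ct y u;
  regular_int : forall rho, profile rho ->
    mu.-integrable `[0 : R, 1] (EFin \o (fun u => Ct (rho u) u));
  regular_t : forall x t u, 0 <= x -> types t -> types u -> t <= u ->
    (\int[mu]_(s in `[t, u]) Ct x s = C x u - C x t)%R }.

Lemma cost_regular (C : R -> R -> R) : differentiable_cost C ->
  (forall x t, 0 < x -> types t -> 0 <= dt (dq C) x t) ->
  regular_cost C (dq C) (dt C).
Proof.
move=> dC Cqt; split.
- exact: is_derive_dq.
- exact: dq_homo.
- exact: dt_homo.
- by move=> rho; exact: profile_dt_integrable.
- exact: integral_dt.
Qed.

Lemma profile_integrableS (phi : R -> R) t u : types t -> types u ->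
  mu.-integrable `[0 : R, 1] (EFin \o phi) ->
  mu.-integrable `[t, u] (EFin \o phi).
Proof. by move=> Tt Tu; apply: integrableS => //; exact: types_itv. Qed.

Lemma regular_combination g (C Cq Ct D Dq Dt : R -> R -> R) : 0 <= g ->
  regular_cost C Cq Ct -> regular_cost D Dq Dt ->
  regular_cost (fun x t => C x t * g + D x t)
    (fun x t => Cq x t * g + Dq x t) (fun x t => Ct x t * g + Dt x t).
Proof.
move=> g0 rC rD.
have int_rho rho : profile rho ->
    mu.-integrable `[0 : R, 1] (EFin \o (fun u => Ct (rho u) u * g)).
  move=> pr.
  have : mu.-integrable `[0 : R, 1] (fun u => (g%:E * (Ct (rho u) u)%:E)%E).
    by apply: integrableZl => //; exact: (regular_int rC).
  by apply: eq_integrable => //= u _; rewrite mulrC.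
split.
- move=> x t x0 Tt.
  have dC := regular_q rC x0 Tt; have dD := regular_q rD x0 Tt.
  have -> : (fun y => C y t * g + D y t) = (g *: C^~ t) + D^~ t.
    by apply/funext => y; rewrite mulrC.
  by apply: is_deriveD; rewrite mulrC; exact: is_deriveZ.
- move=> x t u x0 Tt Tu tu; apply: lerD; last exact: (regular_qt rD).
  by apply: ler_wpM2r => //; exact: (regular_qt rC).
- move=> x y u x0 xy Tu; apply: lerD; last exact: (regular_tq rD).
  by apply: ler_wpM2r => //; exact: (regular_tq rC).
- move=> rho pr.
  have : mu.-integrable `[0 : R, 1]
      (fun u => ((Ct (rho u) u * g)%:E + (Dt (rho u) u)%:E)%E).
    by apply: integrableD => //; [exact: int_rho|exact: (regular_int rD)].
  exact: eq_integrable.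
- move=> x t u x0 Tt Tu tu; rewrite RintegralD//.
  + rewrite RintegralZr//; last first.
      by apply: profile_integrableS => //; exact: (regular_int rC (profile_cst x0)).
    by rewrite (regular_t rC)// (regular_t rD)//; ring.
  + by apply: profile_integrableS => //; exact: (int_rho _ (profile_cst x0)).
  + by apply: profile_integrableS => //; exact: (regular_int rD (profile_cst x0)).
Qed.

Lemma Rintegral_split (phi : R -> R) t m u : t <= m -> m <= u ->
  mu.-integrable `[t, u] (EFin \o phi) ->
  (\int[mu]_(s in `[t, u]) phi s =
   \int[mu]_(s in `[t, m]) phi s + \int[mu]_(s in `[m, u]) phi s)%R.
Proof.
move=> tm mu' ip; apply/eqP; rewrite addrC -subr_eq; apply/eqP.
rewrite Rintegral_itvB ?bnd_simp//.
apply: Rintegral_itv_obnd_cbnd; apply: integrableS ip => //.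
by move=> s; rewrite /= !in_itv /= => /andP[/ltW /(le_trans tm) -> ->].
Qed.

(** The right end point is negligible; it has to be excluded because [inverse_gt] says nothing at
    the cutoff type. *)
Lemma eq_Rintegral_itvco (phi psi : R -> R) t u :
  mu.-integrable `[t, u] (EFin \o phi) ->
  mu.-integrable `[t, u] (EFin \o psi) ->
  (forall s, t <= s < u -> phi s = psi s) ->
  (\int[mu]_(s in `[t, u]) phi s = \int[mu]_(s in `[t, u]) psi s)%R.
Proof.
move=> iphi ipsi E.
have sub : `[t, u[ `<=` `[t, u].
  by move=> s; rewrite /= !in_itv /= => /andP[-> /ltW].
rewrite -!Rintegral_itv_bndo_bndc; first last.
- exact: integrableS iphi.
- exact: integrableS ipsi.
by apply: eq_Rintegral => s; rewrite inE /= in_itv /=; exact: E.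
Qed.

Lemma eq_Rintegral_itvoc (phi psi : R -> R) t u :
  mu.-integrable `[t, u] (EFin \o phi) ->
  mu.-integrable `[t, u] (EFin \o psi) ->
  (forall s, t < s <= u -> phi s = psi s) ->
  (\int[mu]_(s in `[t, u]) phi s = \int[mu]_(s in `[t, u]) psi s)%R.
Proof.
move=> iphi ipsi E.
have sub : `]t, u] `<=` `[t, u].
  by move=> s; rewrite /= !in_itv /= => /andP[/ltW -> ->].
rewrite -!Rintegral_itv_obnd_cbnd; first last.
- exact: integrableS iphi.
- exact: integrableS ipsi.
by apply: eq_Rintegral => s; rewrite inE /= in_itv /=; exact: E.
Qed.

End RegularCosts.

(** * Integral bounds along deviations in quality *)

Section Envelope.
Set Implicit Arguments.
Unset Strict Implicit.
Context {R : realType}.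
Implicit Types (t u x y : R).
Local Notation mu := (@lebesgue_measure R).

Lemma is_derive_near_le (phi : R -> R) x l : is_derive x 1 phi l ->
  forall e, 0 < e -> exists2 del, 0 < del &
    forall y, `|y - x| < del -> `|phi y - phi x| <= e.
Proof.
move=> [/derivable1_diffP/differentiable_continuous/cvgrPdist_le phix _] e e0.
have /nbhs_ballP[del /= del0 H] := phix e e0.
by exists del => // y; rewrite distrC => /H; rewrite distrC.
Qed.

Variable q : R -> R.
Hypothesis q_qual : quality_function q.
Variables C Cq Ct : R -> R -> R.
Hypothesis rC : regular_cost C Cq Ct.
Let pq := quality_profile q_qual.

Let int_profile rho t u : types t -> types u -> profile rho ->
  mu.-integrable `[t, u] (EFin \o (fun s => Ct (rho s) s)).
Proof.
by move=> Tt Tu pr; exact: (profile_integrableS Tt Tu (regular_int rC pr)).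
Qed.

Let le_profile rho rho' t u : types t -> types u ->
  profile rho -> profile rho' -> (forall s, rho s <= rho' s) ->
  \int[mu]_(s in `[t, u]) Ct (rho s) s <= \int[mu]_(s in `[t, u]) Ct (rho' s) s.
Proof.
move=> Tt Tu pr pr' le; apply: le_Rintegral => //.
- exact: (@int_profile rho).
- exact: (@int_profile rho').
- move=> s; rewrite /= in_itv /= => stu.
  have Ts := types_between Tt Tu stu.
  by apply: (regular_tq rC) => //; exact: pr.1.
Qed.

(* Instead of exchanging the order of integration in the double integral of
   [C_{q theta}] over the region below the graph of [q], [phi] is compared with
   the integral as a function of its upper bound [x]. *)
Lemma climb (phi phi' : R -> R) t tau x :
  types t -> types tau -> t <= tau -> 0 < q tau -> q tau <= x ->
  (forall y, q tau <= y <= x -> is_derive y 1 phi (phi' y)) ->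
  (forall y, q tau <= y <= x ->
    phi' y <= Cq y (Num.max t (inverse q y)) - Cq y t) ->
  phi x <= phi (q tau) - (C (q tau) tau - C (q tau) t)
    + \int[mu]_(u in `[t, tau]) Ct (Num.min (q u) x) u.
Proof.
move=> Tt Ttau ttau q0 qx dphi phi'_le.
pose J y := \int[mu]_(u in `[t, tau]) Ct (Num.min (q u) y) u.
have Jq : J (q tau) = C (q tau) tau - C (q tau) t.
  rewrite -(regular_t rC) ?(ltW q0)//.
  apply: eq_Rintegral => u; rewrite inE /= in_itv /= => utt.
  have Tu := types_between Tt Ttau utt.
  by rewrite min_r//; apply: pq.2 => //; case/andP: utt.
have pmin y : q tau <= y -> profile (fun u => Num.min (q u) y).
  by move=> qy; apply: profile_min => //; apply: le_trans (ltW q0) qy.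
have J_homo y z : q tau <= y -> y <= z -> J y <= J z.
  move=> qy yz; apply: le_profile => //.
  - exact: pmin.
  - by apply: pmin; exact: le_trans yz.
  - by move=> s; rewrite le_min !ge_min lexx yz orbT.
have dE (c m : R) : is_derive c 1 phi (phi' c) -> 0 < c -> types m ->
    is_derive c 1 (phi - (C^~ m - C^~ t)) (phi' c - (Cq c m - Cq c t)).
  move=> dc c0 Tm.
  have dm := regular_q rC c0 Tm; have dt := regular_q rC c0 Tt.
  by apply: is_deriveB.
suff : phi x - J x <= phi (q tau) - J (q tau) by rewrite Jq /J; lra.
apply: (@support_ge _ (fun y => phi y - J y)) => //.
- move=> c /andP[qc cx].
  have c0 : 0 < c by exact: lt_trans qc.
  have qcx : q tau <= c <= x by rewrite (ltW qc).
  (* The type where the graph of [q] falls to the level [c], clipped at [t]: between [t] and [m] one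
     has [q u >= c]. *)
  set m := Num.max t (inverse q c).
  have tm : t <= m by rewrite le_max lexx.
  have ic : inverse q c <= tau.
    by rewrite -(inverseK q_qual Ttau); apply: inverse_homo => //; exact: ltW.
  have mtau : m <= tau by rewrite ge_max ttau.
  have Tm : types m by apply: types_between Tt Ttau _; rewrite tm.
  (* Freezing [m] at its value for [c] makes the support differentiable although [J] need not be. *)
  exists (phi - (C^~ m - C^~ t)), (phi' c - (Cq c m - Cq c t)); split.
  + exact: dE (dphi c qcx) c0 Tm.
  + by rewrite subr_le0; exact: phi'_le.
  + move=> y /andP[qy yc].
    change (phi c - J c - (phi y - J y) <= phi c - (C c m - C c t)
      - (phi y - (C y m - C y t))).
    suff : (C c m - C c t) - (C y m - C y t) <= J c - J y by lra.
    have y0 : 0 <= y by apply: le_trans (ltW q0) qy.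
    rewrite -!(regular_t rC)// ?(ltW c0)//.
    have Jsplit z : q tau <= z -> J z =
        \int[mu]_(u in `[t, m]) Ct (Num.min (q u) z) u
        + \int[mu]_(u in `[m, tau]) Ct (Num.min (q u) z) u.
      move=> qz; apply: Rintegral_split => //.
      by apply: (@int_profile (fun u => Num.min (q u) z)) => //; exact: pmin.
    rewrite (Jsplit c (ltW qc)) (Jsplit y qy).
    (* Beyond [m] the integral can only shrink when the level drops from [c] to [y]; before [m] the
       minimum is the level itself, which gives exactly the cost increments of the support. *)
    have tail : \int[mu]_(u in `[m, tau]) Ct (Num.min (q u) y) u <=
        \int[mu]_(u in `[m, tau]) Ct (Num.min (q u) c) u.
      apply: le_profile => //; [exact: pmin|by apply: pmin; exact: ltW|].
      by move=> s; rewrite le_min !ge_min lexx (ltW yc) orbT.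
    have head z : q tau <= z -> z <= c ->
        \int[mu]_(u in `[t, m]) Ct (Num.min (q u) z) u =
        \int[mu]_(u in `[t, m]) Ct z u.
      move=> qz zc; apply: eq_Rintegral_itvco.
      - by apply: (@int_profile (fun u => Num.min (q u) z)) => //; exact: pmin.
      - apply: (@int_profile (fun=> z)) => //; apply: profile_cst.
        by apply: le_trans (ltW q0) qz.
      - move=> s /andP[ts sm].
        have Ts : types s by apply: types_between Tt Tm _; rewrite ts ltW.
        rewrite min_r//; apply: le_trans zc _; apply: (inverse_gt q_qual) => //.
        by move: sm; rewrite lt_max ltNge ts.
    rewrite (head c (ltW qc) (lexx c)) (head y qy (ltW yc)).
    by move: tail; lra.
(* [phi] is continuous and [J] nondecreasing, so [phi - J] can only jump downwards to the right of
   [c]. *)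
- move=> c /andP[qc cx] e e0.
  have [|del del0 H] := is_derive_near_le (dphi c _) e0; first by rewrite qc ltW.
  exists del => // y yx /andP[cy yd].
  have := H y; rewrite gtr0_norm ?subr_gt0// ltrBlDl => /(_ yd).
  rewrite ler_norml => /andP[_ h].
  have := J_homo c y qc (ltW cy).
  move=> HJ; change (phi y - J y <= phi c - J c + e); lra.
Qed.

(** Counterpart of [climb] for lowering the quality below [q tau] by a type above [tau]: truncation
    from below replaces truncation from above. *)
Lemma descend (phi phi' : R -> R) t tau x :
  types t -> types tau -> tau <= t -> 0 < x -> x <= q tau ->
  (forall y, x <= y <= q tau -> is_derive y 1 phi (phi' y)) ->
  (forall y, x <= y <= q tau ->
    Cq y (Num.min t (inverse q y)) - Cq y t <= phi' y) ->
  phi x <= phi (q tau) + (C (q tau) t - C (q tau) tau)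
    - \int[mu]_(u in `[tau, t]) Ct (Num.max (q u) x) u.
Proof.
move=> Tt Ttau taut x0 xq dphi phi'_ge.
pose J y := \int[mu]_(u in `[tau, t]) Ct (Num.max (q u) y) u.
have q0 : 0 < q tau by exact: lt_le_trans xq.
have Jq : J (q tau) = C (q tau) t - C (q tau) tau.
  rewrite -(regular_t rC) ?(ltW q0)//.
  apply: eq_Rintegral => u; rewrite inE /= in_itv /= => utt.
  have Tu := types_between Ttau Tt utt.
  by rewrite max_r//; apply: pq.2 => //; case/andP: utt.
have pmax y : x <= y -> profile (fun u => Num.max (q u) y).
  by move=> xy; apply: profile_max => //; apply: le_trans (ltW x0) xy.
have J_homo y z : x <= y -> y <= z -> J y <= J z.
  move=> xy yz; apply: le_profile => //.
  - exact: pmax.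
  - by apply: pmax; exact: le_trans yz.
  - by move=> s; rewrite ge_max !le_max lexx yz orbT.
suff : phi x + J x <= phi (q tau) + J (q tau) by rewrite Jq /J; lra.
apply: (@support_le _ (fun y => phi y + J y)) => //.
- move=> c /andP[xc cq].
  have c0 : 0 < c by exact: lt_le_trans xc.
  have xcq : x <= c <= q tau by rewrite xc ltW.
  (* Now the part of the graph below the level [c] lies to the right of [m], and there the maximum
     is the level itself. *)
  set m := Num.min t (inverse q c).
  have mt : m <= t by rewrite ge_min lexx.
  have ic : tau <= inverse q c.
    by rewrite -{1}(inverseK q_qual Ttau); apply: inverse_homo => //; exact: ltW.
  have taum : tau <= m by rewrite le_min taut.
  have Tm : types m by apply: types_between Ttau Tt _; rewrite taum.
  exists (phi + (C^~ t - C^~ m)), (phi' c + (Cq c t - Cq c m)); split.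
  + have dc := dphi c xcq.
    have dm := regular_q rC c0 Tm; have dt := regular_q rC c0 Tt.
    by apply: is_deriveD.
  + by have := phi'_ge c xcq; rewrite -/m; lra.
  + move=> y /andP[cy yq].
    change (phi y + (C y t - C y m) - (phi c + (C c t - C c m)) <=
      phi y + J y - (phi c + J c)).
    suff : (C y t - C y m) - (C c t - C c m) <= J y - J c by lra.
    have y0 : 0 <= y by apply: ltW; exact: lt_trans cy.
    have xy : x <= y by apply: le_trans (ltW cy).
    rewrite -!(regular_t rC)// ?(ltW c0)//.
    have Jsplit z : x <= z -> J z =
        \int[mu]_(u in `[tau, m]) Ct (Num.max (q u) z) u
        + \int[mu]_(u in `[m, t]) Ct (Num.max (q u) z) u.
      move=> xz; apply: Rintegral_split => //.
      by apply: (@int_profile (fun u => Num.max (q u) z)) => //; exact: pmax.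
    rewrite (Jsplit c xc) (Jsplit y xy).
    have head : \int[mu]_(u in `[tau, m]) Ct (Num.max (q u) c) u <=
        \int[mu]_(u in `[tau, m]) Ct (Num.max (q u) y) u.
      apply: le_profile => //; [exact: pmax|exact: pmax|].
      by move=> s; rewrite ge_max !le_max lexx (ltW cy) orbT.
    have tail z : c <= z ->
        \int[mu]_(u in `[m, t]) Ct (Num.max (q u) z) u =
        \int[mu]_(u in `[m, t]) Ct z u.
      move=> cz; have xz : x <= z by exact: le_trans cz.
      apply: eq_Rintegral_itvoc.
      - by apply: (@int_profile (fun u => Num.max (q u) z)) => //; exact: pmax.
      - apply: (@int_profile (fun=> z)) => //; apply: profile_cst.
        by apply: le_trans (ltW x0) xz.
      - move=> s /andP[ms st].
        have Ts : types s by apply: types_between Tm Tt _; rewrite st ltW.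
        rewrite max_r//; apply: (le_trans _ cz); apply/ltW.
        apply: inverse_lt => //.
        by move: ms; rewrite gt_min ltNge st.
    rewrite (tail c (lexx c)) (tail y (ltW cy)).
    by move: head; lra.
- move=> c /andP[xc cq] e e0.
  have [|del del0 H] := is_derive_near_le (dphi c _) e0; first by rewrite cq ltW.
  exists del => // y xy /andP[yd yc].
  have := H y; rewrite ltr0_norm ?subr_lt0// opprB ltrBlDl -ltrBlDr => /(_ yd).
  rewrite ler_norml => /andP[_ h].
  have := J_homo y c xy (ltW yc).
  move=> HJ; change (phi y + J y <= phi c + J c + e); lra.
Qed.

End Envelope.

(** * Optimality of imitating one's own type *)

Section Deviations.
Set Implicit Arguments.
Unset Strict Implicit.
Context {R : realType}.
Implicit Types (t u x y : R).
Local Notation mu := (@lebesgue_measure R).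

Lemma is_derive_ge0_le (phi phi' : R -> R) x y : x <= y ->
  (forall z, x <= z <= y -> is_derive z 1 phi (phi' z)) ->
  (forall z, x <= z <= y -> 0 <= phi' z) -> phi x <= phi y.
Proof.
move=> xy dphi phi'0; apply: support_le => //.
- move=> c /andP[xc cy]; have xcy : x <= c <= y by rewrite xc ltW.
  by exists phi, (phi' c); split => //; [exact: dphi|exact: phi'0].
- move=> c /andP[xc cy] e e0.
  have [|del del0 H] := is_derive_near_le (dphi c _) e0; first by rewrite ltW.
  exists del => // z xz /andP[cz zc].
  have := H z; rewrite ltr0_norm ?subr_lt0// opprB ltrBlDl -ltrBlDr => /(_ cz).
  by rewrite ler_norml lerBlDl => /andP[_].
Qed.

Variable q : R -> R.
Hypothesis q_qual : quality_function q.
Variables CP CI : R -> R -> R.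
Hypothesis rP : regular_cost CP (dq CP) (dt CP).
Hypothesis rI : regular_cost CI (dq CI) (dt CI).
Hypothesis CPt_ge0 : forall x t, 0 <= x -> types t -> 0 <= dt CP x t.
Hypothesis CIt_ge0 : forall x t, 0 <= x -> types t -> 0 <= dt CI x t.
Hypothesis CIq_ge0 : forall x t, 0 < x -> types t -> 0 <= dq CI x t.
Hypothesis CI_gt0 : forall x t, 0 < x -> types t -> 0 < CI x t.
Variable G : R -> R.
Hypothesis G_ge0 : forall t, 0 <= G t.
Hypothesis G_le1 : forall t, G t <= 1.
Hypothesis G_homo : forall t u, t <= u -> G u <= G t.
Hypothesis G_lt : forall t u, types t -> types u -> t < u -> G u < G t.

Let G_gt0 t : types t -> t < 1 -> 0 < G t.
Proof. by move=> Tt t1; apply: le_lt_trans (G_ge0 1) (G_lt Tt types1 t1). Qed.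

Let pq := quality_profile q_qual.

(** The informational rent with the winning probability abstracted to a decreasing function [G]. *)
Definition rent t u := \int[mu]_(s in `[t, u])
  (dt CP (q s) s * G s + dt CI (q s) s).

Let rent_int t u : types t -> types u -> mu.-integrable `[t, u]
  (EFin \o (fun s => dt CP (q s) s * G s + dt CI (q s) s)).
Proof.
move=> Tt Tu; apply: profile_integrableS => //.
have iP := regular_int rP pq.
(* [G] is monotone, hence measurable, and takes values in [[0, 1]], so it preserves
   integrability. *)
have iG : mu.-integrable `[0 : R, 1] (EFin \o (fun s => dt CP (q s) s * G s)).
  apply: le_integrable (iP) => //.
    apply/measurable_EFinP; apply: measurable_funM.
      by apply/measurable_EFinP; exact: measurable_int iP.
    exact: nonincreasing_measurable.
  move=> s _; rewrite lee_fin normrM ler_piMr//.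
  by rewrite ger0_norm.
have : mu.-integrable `[0 : R, 1]
    (fun s => ((dt CP (q s) s * G s)%:E + (dt CI (q s) s)%:E)%E).
  by apply: integrableD => //; exact: (regular_int rI pq).
exact: eq_integrable.
Qed.

Lemma rent_split t u : types t -> types u -> t <= u ->
  rent t 1 = rent t u + rent u 1.
Proof.
move=> Tt Tu tu; apply: Rintegral_split => //; first by case/andP: Tu.
exact: rent_int Tt types1.
Qed.

Lemma rent_ge0 t u : types t -> types u -> 0 <= rent t u.
Proof.
move=> Tt Tu; apply: Rintegral_ge0 => s; rewrite /= in_itv /= => stu.
have Ts := types_between Tt Tu stu; have qs := quality_ge0 q_qual Ts.
by rewrite addr_ge0 ?mulr_ge0 ?CPt_ge0 ?CIt_ge0.
Qed.

Variable s : R -> R.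
Hypothesis s_derive : forall x, 0 <= x -> inverse q x < 1 ->
  is_derive x 1 s
    (dq CP x (inverse q x) + dq CI x (inverse q x) / G (inverse q x)).

Definition ask t := CP (q t) t + (CI (q t) t + rent t 1) / G t.

Definition eqscore t := s (q t) - ask t.

(* The interim profit of a firm of type [t] that chooses quality [x] and the
   price at which its score is that of type [tau]. *)
Definition deviation x tau t := (s x - eqscore tau - CP x t) * G tau - CI x t.

(** Multiplication by [G tau] cancels the division in the price: type [tau] earns its rent, and any
    other type differs only by its own cost. *)
Lemma deviation_self tau t : types tau -> tau < 1 ->
  deviation (q tau) tau t =
  rent tau 1 + (CP (q tau) tau * G tau + CI (q tau) tau)
    - (CP (q tau) t * G tau + CI (q tau) t).
Proof.
move=> Ttau tau1; rewrite /deviation /eqscore /ask.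
by field; rewrite gt_eqF// G_gt0.
Qed.

Section FixedDeviation.
Variables tau t : R.
Hypotheses (Ttau : types tau) (tau1 : tau < 1) (Tt : types t).

Let phi x := s x * G tau - (CP x t * G tau + CI x t).
Let phi' x := (dq CP x (inverse q x) + dq CI x (inverse q x) / G (inverse q x))
   * G tau - (dq CP x t * G tau + dq CI x t).

Let phi_derive x : 0 < x -> inverse q x < 1 -> is_derive x 1 phi (phi' x).
Proof.
move=> x0 ix1; have ds := s_derive (ltW x0) ix1.
have dC := regular_q (regular_combination (G_ge0 tau) rP rI) x0 Tt.
have -> : phi = (G tau *: s) - (fun y => CP y t * G tau + CI y t).
  by apply/funext => y; rewrite /phi mulrC.
apply: is_deriveB; rewrite mulrC; exact: is_deriveZ.
Qed.

Let deviationE x : deviation x tau t = phi x - eqscore tau * G tau.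
Proof. by rewrite /deviation /phi; ring. Qed.

(** The rule divides [C^I_q] by [G (inverse q x)], which is at least [G tau], so the investment term
    shrinks; marginal costs then grow from the type [inverse q x] to [m]. *)
Let slope_le x m : 0 < x -> types m -> inverse q x <= tau -> inverse q x <= m ->
  phi' x <= dq CP x m * G tau + dq CI x m - (dq CP x t * G tau + dq CI x t).
Proof.
move=> x0 Tm itau im; rewrite /phi' lerD2r mulrDl.
have Ti := types_inverse q x; have i1 := le_lt_trans itau tau1.
apply: lerD; first by apply: ler_wpM2r => //; exact: (regular_qt rP).
apply: le_trans (regular_qt rI x0 Ti Tm im).
rewrite -mulrA ler_piMr ?CIq_ge0// mulrC ler_pdivrMr ?G_gt0// mul1r.
exact: G_homo.
Qed.

(** Both comparisons of [slope_le] reverse: [G tau / G (inverse q x)] is at least [1], and [m] lies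
    below [inverse q x]. *)
Let slope_ge x m : 0 < x -> types m -> inverse q x < 1 ->
  tau <= inverse q x -> m <= inverse q x ->
  dq CP x m * G tau + dq CI x m - (dq CP x t * G tau + dq CI x t) <= phi' x.
Proof.
move=> x0 Tm i1 itau im; rewrite /phi' lerD2r mulrDl.
have Ti := types_inverse q x.
apply: lerD; first by apply: ler_wpM2r => //; exact: (regular_qt rP).
apply: le_trans (regular_qt rI x0 Tm Ti im) _.
rewrite -mulrA ler_peMr ?CIq_ge0// mulrC ler_pdivlMr ?G_gt0// mul1r.
exact: G_homo.
Qed.

Let qtau0 := quality_gt0 q_qual Ttau tau1.

Let inverse_le_tau y : q tau <= y -> inverse q y <= tau.
Proof. by move=> qy; rewrite -(inverseK q_qual Ttau); exact: inverse_homo. Qed.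

Let inverse_ge_tau y : y <= q tau -> tau <= inverse q y.
Proof. by move=> yq; rewrite -{1}(inverseK q_qual Ttau); exact: inverse_homo. Qed.

(** Both changes lower the integrand: [rho <= q], and [G tau <= G v] for [v <= tau]. *)
Let rent_ge_low rho u : types u -> t <= u -> tau = u -> profile rho ->
  (forall v, types v -> rho v <= q v) ->
  \int[mu]_(v in `[t, u]) (dt CP (rho v) v * G tau + dt CI (rho v) v)
    <= rent t u.
Proof.
move=> Tu tu tauu pr rq; apply: le_Rintegral => //.
- apply: (profile_integrableS Tt Tu).
  exact: (regular_int (regular_combination (G_ge0 tau) rP rI) pr).
- exact: rent_int.
- move=> v; rewrite /= in_itv /= => tvu; have Tv := types_between Tt Tu tvu.
  apply: lerD; last by apply: (regular_tq rI) => //; [exact: pr.1|exact: rq].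
  apply: ler_pM => //; first by apply: CPt_ge0 => //; exact: pr.1.
    by apply: (regular_tq rP) => //; [exact: pr.1|exact: rq].
  by apply: G_homo; rewrite tauu; case/andP: tvu.
Qed.

(** Above [tau] both comparisons turn round: [q <= rho], and [G v <= G tau]. *)
Let rent_le_high rho : tau <= t -> profile rho ->
  (forall v, types v -> q v <= rho v) ->
  rent tau t <=
  \int[mu]_(v in `[tau, t]) (dt CP (rho v) v * G tau + dt CI (rho v) v).
Proof.
move=> taut pr rq; apply: le_Rintegral => //.
- exact: rent_int.
- apply: (profile_integrableS Ttau Tt).
  exact: (regular_int (regular_combination (G_ge0 tau) rP rI) pr).
- move=> v; rewrite /= in_itv /= => tvu; have Tv := types_between Ttau Tt tvu.
  have qv := quality_ge0 q_qual Tv.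
  apply: lerD; last by apply: (regular_tq rI) => //; exact: rq.
  apply: ler_pM => //; first by apply: CPt_ge0.
    by apply: (regular_tq rP) => //; exact: rq.
  by apply: G_homo; case/andP: tvu.
Qed.

Lemma deviation_le x : 0 < x -> inverse q x < 1 ->
  deviation x tau t <= rent t 1.
Proof.
move=> x0 ix1.
have rC := regular_combination (G_ge0 tau) rP rI.
have pos y : q tau <= y -> 0 < y by exact: lt_le_trans.
have D0 : phi (q tau) - eqscore tau * G tau =
  rent tau 1 + (CP (q tau) tau * G tau + CI (q tau) tau)
    - (CP (q tau) t * G tau + CI (q tau) t).
  by rewrite -deviationE deviation_self.
(* The integral added by [climb] is at most the rent between [t] and [tau]. *)
have up y : t <= tau -> q tau <= y -> deviation y tau t <= rent t 1.
  move=> ttau qy.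
  have H : phi y <= phi (q tau)
      - ((CP (q tau) tau * G tau + CI (q tau) tau)
         - (CP (q tau) t * G tau + CI (q tau) t))
      + \int[mu]_(u in `[t, tau])
        (dt CP (Num.min (q u) y) u * G tau + dt CI (Num.min (q u) y) u).
    apply: (climb q_qual rC (phi := phi) (phi' := phi')) => // z /andP[qz _].
      by apply: phi_derive; [exact: pos|exact: le_lt_trans (inverse_le_tau qz) tau1].
    apply: slope_le; [exact: pos| |exact: inverse_le_tau|by rewrite le_max lexx orbT].
    by rewrite /Num.max; case: ifP => _ //; exact: types_inverse.
  have py : profile (fun u => Num.min (q u) y).
    by apply: profile_min pq; exact: ltW (pos y qy).
  have min_le v : types v -> Num.min (q v) y <= q v by rewrite ge_min lexx.
  have := rent_ge_low Ttau ttau erefl py min_le.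
  have := rent_split Tt Ttau ttau.
  by move: D0 H; rewrite deviationE; lra.
(* The integral subtracted by [descend] is at least the rent between [tau] and [t]. *)
have down y : tau <= t -> 0 < y -> y <= q tau -> inverse q y < 1 ->
    deviation y tau t <= rent t 1.
  move=> taut y0 yq iy1.
  have H : phi y <= phi (q tau)
      + ((CP (q tau) t * G tau + CI (q tau) t)
         - (CP (q tau) tau * G tau + CI (q tau) tau))
      - \int[mu]_(u in `[tau, t])
        (dt CP (Num.max (q u) y) u * G tau + dt CI (Num.max (q u) y) u).
    apply: (descend q_qual rC (phi := phi) (phi' := phi')) => // z /andP[yz zq];
      have z0 : 0 < z by [exact: lt_le_trans yz].
      by apply: phi_derive => //; exact: le_lt_trans (inverse_homo q yz) iy1.
    apply: slope_ge => //; last by rewrite ge_min lexx orbT.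
    - by rewrite /Num.min; case: ifP => _ //; exact: types_inverse.
    - exact: le_lt_trans (inverse_homo q yz) iy1.
    - exact: inverse_ge_tau.
  have py : profile (fun u => Num.max (q u) y) by apply: profile_max pq; exact: ltW.
  have le_max v : types v -> q v <= Num.max (q v) y by rewrite le_max lexx.
  have := rent_le_high taut py le_max.
  have := rent_split Ttau Tt taut.
  by move: D0 H; rewrite deviationE; lra.
have [ttau|/ltW taut] := leP t tau; have [qx|/ltW xq] := leP (q tau) x.
- exact: up.
(* Between [x] and [q tau] one has [t <= tau <= inverse q y], so raising the quality to [q tau] does
   not lower the profit, and [up] applies there. *)
- apply: le_trans (up _ ttau (lexx _)); rewrite !deviationE lerD2r.
  apply: (is_derive_ge0_le (phi := phi) (phi' := phi')) => // y /andP[xy yq];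
    have y0 : 0 < y by [exact: lt_le_trans xy];
    have iy1 := le_lt_trans (inverse_homo q xy) ix1.
    exact: phi_derive.
  have := slope_ge y0 Tt iy1 (inverse_ge_tau yq) (le_trans ttau (inverse_ge_tau yq)).
  by rewrite subrr.
(* Dually, [inverse q y <= tau <= t] above [q tau], so lowering the quality to [q tau] does not
   lower the profit, and [down] applies there. *)
- apply: le_trans (down _ taut qtau0 (lexx _) _); last by rewrite inverseK.
  rewrite !deviationE lerD2r -lerN2.
  apply: (is_derive_ge0_le (phi := - phi) (phi' := - phi')) => // y /andP[qy yx];
    have iy1 := le_lt_trans (inverse_le_tau qy) tau1.
    by apply: is_deriveN; exact: phi_derive (pos y qy) iy1.
  have := slope_le (pos y qy) Tt (inverse_le_tau qy) (le_trans (inverse_le_tau qy) taut).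
  by rewrite subrr -oppr_ge0.
- exact: down.
Qed.

End FixedDeviation.

(** Otherwise type [u], keeping quality [q u], could adopt the score of [t]: with no smaller margin
    and a larger winning probability it would earn more than its rent, against [deviation_le]. *)
Lemma eqscore_lt t u : types t -> types u -> t < u -> u < 1 ->
  eqscore u < eqscore t.
Proof.
move=> Tt Tu tu u1; rewrite ltNge; apply/negP => le_tu.
have t1 := lt_trans tu u1.
have qu0 := quality_gt0 q_qual Tu u1.
have := deviation_le Tt t1 Tu qu0; rewrite inverseK// => /(_ u1).
have : (s (q u) - eqscore u - CP (q u) u) * G u = CI (q u) u + rent u 1.
  by rewrite /eqscore /ask; field; rewrite gt_eqF// G_gt0.
rewrite /deviation; set v := s (q u) - CP (q u) u.
rewrite ![_ - _ - CP (q u) u]addrAC -/v => E.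
have CI0 := CI_gt0 qu0 Tu.
(* The positive investment cost forces a positive margin, so a larger winning probability is a
   strict gain. *)
have E0 : 0 < (v - eqscore u) * G u.
  by rewrite E ltr_pwDl// rent_ge0//; exact: types1.
have vu : 0 < v - eqscore u by move: E0; rewrite pmulr_lgt0// G_gt0.
apply/negP; rewrite -ltNge.
have lt1 : (v - eqscore u) * G u < (v - eqscore u) * G t.
  by rewrite ltr_pM2l//; exact: G_lt.
have le2 : (v - eqscore u) * G t <= (v - eqscore t) * G t.
  by rewrite ler_wpM2r// lerB.
by move: lt1 le2; rewrite E; lra.
Qed.

End Deviations.

(** * Distribution of the rivals' types *)

Section TypeModel.
Set Implicit Arguments.
Unset Strict Implicit.
Context {R : realType} {d : measure_display} {Omega : measurableType d}.
Context {P : probability Omega R} {n : nat}.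
Variables (X : 'I_n -> {RV P >-> R}) (F f : R -> R).
Hypothesis HX : type_model X F f.
Implicit Types (t u c : R) (i j : 'I_n).

Let density := types_density HX.

Lemma cdf_homo i t u : t <= u -> F t <= F u.
Proof.
move=> tu; rewrite -lee_fin -!(types_cdf HX i); exact: cdf_nondecreasing.
Qed.

Lemma cdf_01 i t : 0 <= F t <= 1.
Proof.
rewrite -!lee_fin -!(types_cdf HX i); apply/andP; split; first exact: cdf_ge0.
exact: cdf_le1.
Qed.

Lemma cdf_at1 i : F 1 = 1.
Proof.
apply: EFin_inj; rewrite -(types_cdf HX i) -(probability_setT P).
congr (P _); apply/seteqP; split=> // w _.
by rewrite /= in_itv /=; case/andP: (types_in HX i w).
Qed.

Lemma survival j t : P (X j @^-1` `]t, +oo[) = (1 - F t)%:E.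
Proof.
have -> : X j @^-1` `]t, +oo[ = ~` (X j @^-1` `]-oo, t]).
  by apply/seteqP; split=> w /=; rewrite !in_itv /= andbT ltNge => /negP.
rewrite probability_setC; last exact: measurable_funPTI.
by rewrite EFinB -(types_cdf HX j).
Qed.

Lemma type_atom j c : types c -> P (X j @^-1` [set c]) = 0%E.
Proof.
move=> Tc.
have mA : measurable (X j @^-1` [set c]) by exact: measurable_funPTI.
have bound u : u < c -> (P (X j @^-1` [set c]) <= (F c - F u)%:E)%E.
  move=> uc.
  have mB : measurable (X j @^-1` `]-oo, u]) by exact: measurable_funPTI.
  rewrite EFinB leeBrDr// -!(types_cdf HX j) -measureU//.
    apply: le_measure; rewrite ?inE; [exact: measurableU|exact: measurable_funPTI|].
    move=> w /=; rewrite !in_itv /= => -[->|/le_trans]//.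
    by apply; exact: ltW.
  apply/seteqP; split=> // w [/= ->]; rewrite in_itv /= => cu.
  by have := lt_le_trans uc cu; rewrite ltxx.
apply/eqP; rewrite eq_le measure_ge0 andbT.
(* The Lipschitz bound holds on [[0, 1]] only, so [c = 0] is settled by [F 0 = 0] and
   [F (-1) >= 0]. *)
have [c0 c1] := andP Tc; move: c0; rewrite (le_eqVlt 0 c) => /predU1P[c0|c0].
  apply: le_trans (bound (-1) _) _; first by rewrite -c0 ltrN10.
  rewrite lee_fin -c0 (cdf_at0 density) sub0r oppr_le0.
  by case/andP: (cdf_01 j (-1)).
apply/lee_addgt0Pr => e e0; rewrite add0e.
have [M M0 HM] := cdf_lipschitz density (density_gt0 HX) (density_diff HX).
have M1 : 0 < M + 1 by rewrite ltr_wpDl.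
pose u := Num.max 0 (c - e / (M + 1)).
have uc : u < c by rewrite gt_max c0 /= ltrBlDr ltrDl divr_gt0.
have Tu : types u.
  rewrite /types /= le_max lexx /=; exact: le_trans (ltW uc) c1.
apply: le_trans (bound u uc) _; rewrite lee_fin.
apply: le_trans (HM u c Tu Tc (ltW uc)) _.
have cu : c - u <= e / (M + 1) by rewrite lerBlDr -lerBlDl le_max lexx orbT.
apply: le_trans (_ : (M + 1) * (c - u) <= e).
  by apply: ler_wpM2r; [rewrite subr_ge0 ltW|rewrite lerDl].
by rewrite mulrC -ler_pdivlMr.
Qed.

Lemma type_neq c : types c -> {ae P, forall w, forall j, X j w != c}.
Proof.
move=> Tc; apply: filter_forall => j.
exists (X j @^-1` [set c]); split; first exact: measurable_funPTI.
  exact: type_atom.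
by move=> w /= /negP; rewrite negbK => /eqP.
Qed.

Lemma prob_all_above i t :
  P [set w | forall j, j != i -> t < X j w] = ((1 - F t) ^+ n.-1)%:E.
Proof.
pose A j := if j == i then setT else `]t, +oo[%classic.
have -> : [set w | forall j, j != i -> t < X j w] =
    [set w | forall j, A j (X j w)].
  apply/seteqP; split=> w /= H j.
    rewrite /A; case: eqP => //= /eqP ji.
    by rewrite in_itv /= andbT; exact: H.
  by move=> ji; have := H j; rewrite /A (negbTE ji) /= in_itv /= andbT.
rewrite (types_indep HX); last by move=> j; rewrite /A; case: eqP.
congr EFin; rewrite (bigD1 i)//= /A eqxx preimage_setT probability_setT mul1r.
rewrite (eq_bigr (fun=> 1 - F t)); last first.
  by move=> j /negbTE ->; rewrite survival.
by rewrite prodr_const cardC1 card_ord.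
Qed.

End TypeModel.

(** * Winning shares and interim profit for a cutoff type *)

Section Auction.
Set Implicit Arguments.
Unset Strict Implicit.
Context {R : realType}.

(* In this form the share is visibly measurable in the types of the rivals. *)
Lemma shareE n (s : R -> \bar R) (b : 'I_n -> R * R) i : share s b i =
  (\prod_(j < n) (score s (b j) <= score s (b i))%E%:R)
  * (\sum_(k < n) (score s (b i) <= score s (b k))%E%:R)^-1.
Proof.
rewrite /share inE; case: forallP => [H|/forallP].
  rewrite big1 ?mul1r; last by move=> j _; rewrite H.
  congr (_ ^-1); rewrite -sum1_card natr_sum big_mkcond; apply: eq_bigr => k _.
  rewrite inE; have -> : [forall j, (score s (b j) <= score s (b k))%E]
      = (score s (b i) <= score s (b k))%E; last by case: ifP.
  by apply/forallP/idP => [/(_ i)//|ik j]; exact: le_trans (H j) ik.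
rewrite negb_forall => /existsP[j /negbTE Hj].
by rewrite (bigD1 j)//= Hj !mul0r.
Qed.

(** Meant for sets of types defined by score comparisons, which are undetermined at the cutoff and
    at type [1]. *)
Lemma measurable_up_to_points (I A : set R) a b : measurable I -> I `<=` A ->
  A `<=` I `|` [set a] `|` [set b] -> measurable A.
Proof.
move=> mI IA AI.
have m1 c : measurable (A `&` [set c]).
  have [Ac|Ac] := pselect (A c).
    by rewrite (_ : _ `&` _ = [set c])//; apply/seteqP; split=> x /=;
      [case|move=> ->].
  rewrite (_ : _ `&` _ = set0)//; apply/seteqP; split=> x //= -[Ax xc].
  by apply: Ac; rewrite -xc.
rewrite (_ : A = I `|` (A `&` [set a]) `|` (A `&` [set b])).
  by apply: measurableU => //; exact: measurableU.
apply/seteqP; split=> [x Ax|x [[/IA//|[]//]|[]//]].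
by case: (AI x Ax) => [[Ix|xa]|xb]; [left; left|left; right|right].
Qed.

Context {d : measure_display} {Omega : measurableType d}.
Context {P : probability Omega R} {n : nat}.
Variables (X : 'I_n -> {RV P >-> R}) (F f : R -> R).
Hypothesis HX : type_model X F f.
Variables (CP CI : R -> R -> R) (s : R -> \bar R) (beta : R -> R * R).

Section Cutoff.
Variables (i : 'I_n) (b : R * R) (tau : R).
Hypothesis Ttau : types tau.
Hypothesis loses : forall v, types v -> v < 1 -> v < tau ->
  (score s b < score s (beta v))%E.
Hypothesis wins : forall v, types v -> v < 1 -> tau < v ->
  (score s (beta v) < score s b)%E.

Let bids w j := if j == i then b else beta (X j w).
Let E := [set w | forall j, j != i -> tau < X j w].

Let measurable_below :
  measurable [set v | types v /\ (score s (beta v) <= score s b)%E].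
Proof.
apply: (@measurable_up_to_points `]tau, 1[ _ tau 1) => //.
  move=> v; rewrite /= in_itv /= => /andP[tv v1]; split.
    by apply: types_between Ttau types1 _; rewrite !ltW.
  apply/ltW/wins => //; by apply: types_between Ttau types1 _; rewrite !ltW.
move=> v [Tv]; have [v0 v1] := andP Tv.
have [->|v1'] := eqVneq v 1; first by right.
have {v1 v1'} v1 : v < 1 by rewrite lt_neqAle v1'.
case: (ltgtP v tau) => [vt|vt|->]; last by left; right.
  by rewrite leNgt loses.
by left; left; rewrite /= in_itv /= vt.
Qed.

Let measurable_above :
  measurable [set v | types v /\ (score s b <= score s (beta v))%E].
Proof.
apply: (@measurable_up_to_points `[0, tau[ _ tau 1) => //.
  move=> v; rewrite /= in_itv /= => /andP[v0 vt].
  have Tv : types v by apply: types_between types0 Ttau _; rewrite v0 ltW.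
  split=> //; apply/ltW/loses => //.
  by apply: lt_le_trans vt _; case/andP: Ttau.
move=> v [Tv]; have [v0 v1] := andP Tv.
have [->|v1'] := eqVneq v 1; first by right.
have {v1 v1'} v1 : v < 1 by rewrite lt_neqAle v1'.
case: (ltgtP v tau) => [vt|vt|->]; last by left; right.
  by left; left; rewrite /= in_itv /= v0.
by rewrite leNgt wins.
Qed.

Let measurable_type_indic (A : set R) j :
  measurable [set v | types v /\ A v] ->
  measurable_fun setT (fun w => (`[< A (X j w) >]%:R : R)).
Proof.
move=> mA.
have -> : (fun w => (`[< A (X j w) >]%:R : R)) =
    \1_(X j @^-1` [set v | types v /\ A v]).
  apply/funext => w; rewrite indicE; congr (_%:R); congr nat_of_bool.
  apply/asboolP/idP => [Aw|]; rewrite inE /=; last by case.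
  by split=> //; exact: (types_in HX).
by apply: measurable_indic; exact: measurable_funPTI.
Qed.

Let measurable_share : measurable_fun setT (fun w => share s (bids w) i).
Proof.
(* The count includes firm [i] itself, so the maximum with [1] changes nothing, and it makes [h]
   monotone, hence measurable. *)
pose h (y : R) := (Num.max 1 y)^-1.
have -> : (fun w => share s (bids w) i) = (fun w =>
    (\prod_(j < n) (score s (bids w j) <= score s b)%E%:R)
    * h (\sum_(k < n) (score s b <= score s (bids w k))%E%:R)).
  apply/funext => w; rewrite shareE.
  have -> : bids w i = b by rewrite /bids eqxx.
  congr (_ * _); rewrite /h max_r// (bigD1 i)//= {1}/bids eqxx lexx lerDl.
  by apply: sumr_ge0.
apply: measurable_funM.
  apply: measurable_prod => j _; rewrite /bids; case: eqP => [_|_].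
    exact: measurable_cst.
  have := @measurable_type_indic (fun v => (score s (beta v) <= score s b)%E) j
    measurable_below.
  by under eq_fun do rewrite asboolb.
apply: (measurableT_comp (f := h)).
  apply: nonincreasing_measurable => // x y xy; rewrite /h lef_pV2 ?posrE;
    try by rewrite lt_max ltr01.
  by rewrite ge_max !le_max lexx xy orbT.
apply: measurable_sum => k; rewrite /bids; case: eqP => [_|_].
  exact: measurable_cst.
have := @measurable_type_indic (fun v => (score s b <= score s (beta v))%E) k
  measurable_above.
by under eq_fun do rewrite asboolb.
Qed.

Let measurable_E : measurable E.
Proof.
have -> : E = \bigcap_(j in [set j | j != i]) (X j @^-1` `]tau, +oo[).
  apply/seteqP; split=> w /= H j /= ji; have := H j ji.
    by rewrite in_itv /= andbT.
  by rewrite /= in_itv /= andbT.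
apply: fin_bigcap_measurable => [|j _]; last exact: measurable_funPTI.
exact: finite_finset.
Qed.

(** A tie requires a rival of type [tau] or [1], a null event; otherwise the bid wins alone or is
    beaten. *)
Let share_ae : {ae P, forall w, share s (bids w) i = \1_E w}.
Proof.
apply: filterS2 (type_neq HX Ttau) (type_neq HX types1) => w neq_tau neq1.
have lt1 j : X j w < 1.
  by rewrite lt_neqAle neq1; case/andP: (types_in HX j w).
rewrite shareE indicE; have -> : bids w i = b by rewrite /bids eqxx.
have [Ew|Ew] := pselect (E w).
  rewrite mem_set// big1 => [|j _]; last first.
    rewrite /bids; case: eqP => [_|/eqP ji]; first by rewrite lexx.
    by rewrite ltW// wins// ?lt1//; [exact: (types_in HX)|exact: Ew].
  rewrite (bigD1 i)//= {1}/bids eqxx lexx big1 ?addr0 ?invr1 ?mulr1// => j ji.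
  rewrite /bids (negbTE ji) leNgt wins//; [exact: (types_in HX)|exact: Ew].
rewrite memNset//; move/existsNP: Ew => [j /not_implyP[ji /negP]].
rewrite -leNgt le_eqVlt (negbTE (neq_tau j)) /= => jt.
rewrite (bigD1 j)//= {1}/bids (negbTE ji) leNgt loses// ?mul0r//.
exact: (types_in HX).
Qed.

Lemma interim_profit_cutoff t :
  interim_profit X CP CI s (fun=> beta) i t b =
  ((b.2 - CP b.1 t) * (1 - F tau) ^+ n.-1 - CI b.1 t)%:E.
Proof.
rewrite /interim_profit unlock.
have mE := measurable_E.
pose a := b.2 - CP b.1 t.
transitivity (\int[P]_w (a * \1_E w - CI b.1 t)%:E)%E.
  apply: ae_eq_integral => //.
  - apply/measurable_EFinP; rewrite /profit.
    under eq_fun do rewrite eqxx.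
    apply: measurable_funB; last exact: measurable_cst.
    by apply: measurable_funB; apply: measurable_funM => //; exact: measurable_share.
  - apply/measurable_EFinP; apply: measurable_funB; last exact: measurable_cst.
    by apply: measurable_funM => //; exact: measurable_indic.
  - apply: filterS share_ae => w Hw _; rewrite /profit eqxx -/(bids w) Hw.
    by congr EFin; rewrite /a; ring.
have iE : P.-integrable setT (fun w => (a * \1_E w)%:E).
  under eq_fun do rewrite EFinM.
  by apply: integrableZl => //; exact: integrable_indic.
rewrite integralB_EFin//; last exact: finite_measure_integrable_cst.
under eq_integral do rewrite EFinM.
rewrite integralZl//; last exact: integrable_indic.
rewrite integral_indic// setIT integral_cst//.
have /= -> := probability_setT P; rewrite mule1.
by have /= -> := prob_all_above HX i tau; rewrite -EFinM -EFinB.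
Qed.

End Cutoff.
End Auction.

(** * From bounds on deviations to the equilibrium *)

Section Equilibrium.
Set Implicit Arguments.
Unset Strict Implicit.
Context {R : realType} {d : measure_display} {Omega : measurableType d}.
Context {P : probability Omega R} {n : nat}.
Hypothesis n_ge2 : (2 <= n)%N.
Variables (X : 'I_n -> {RV P >-> R}) (F f V : R -> R) (CP CI : R -> R -> R).
Hypothesis HX : type_model X F f.
Hypothesis HA : standing_assumptions F f V CP CI.
Variable q : R -> R.
Hypothesis Hq : quality_function q.
Variable s : R -> \bar R.
Hypothesis Hs : score_rule n F CP CI q s.
Implicit Types (t u v x y : R).

Let n_gt0 : (0 < n)%N. Proof. exact: ltnW. Qed.
Let n1_gt0 : (0 < n.-1)%N. Proof. by rewrite -ltnS prednK. Qed.
Let i0 : 'I_n := Ordinal n_gt0.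

Let G t := (1 - F t) ^+ n.-1.

Let F1_ge0 t : 0 <= 1 - F t.
Proof. by rewrite subr_ge0; case/andP: (cdf_01 HX i0 t). Qed.

Let F1_le1 t : 1 - F t <= 1.
Proof. by rewrite gerBl; case/andP: (cdf_01 HX i0 t). Qed.

Let G_ge0 t : 0 <= G t. Proof. exact: exprn_ge0. Qed.

Let G_le1 t : G t <= 1. Proof. exact: exprn_ile1. Qed.

Let G_homo t u : t <= u -> G u <= G t.
Proof.
by move=> tu; apply: lerXn2r => //; rewrite ?nnegrE// lerB// (cdf_homo HX i0).
Qed.

Let G_lt t u : types t -> types u -> t < u -> G u < G t.
Proof.
move=> Tt Tu tu; rewrite /G ltrXn2r//; first by rewrite -lt0n.
rewrite ltrD2l ltrN2.
exact: (cdf_lt (types_density HX) (density_gt0 HX) (density_diff HX)).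
Qed.

Let G1 : G 1 = 0.
Proof. by rewrite /G (cdf_at1 HX i0) subrr expr0n eqn0Ngt n1_gt0. Qed.

Let G_gt0 t : types t -> t < 1 -> 0 < G t.
Proof. by move=> Tt t1; rewrite -G1; exact: G_lt Tt types1 t1. Qed.

Let G_right_lim t : types t -> t < 1 -> forall e, 0 < e ->
  exists v, [/\ types v, t < v, v < 1 & G t - G v < e].
Proof.
move=> Tt t1 e e0; have N0 : 0 < n.-1%:R :> R by rewrite ltr0n.
have [v [Tv tv v1 Hv]] := cdf_right_lim (types_density HX) (density_gt0 HX)
  (density_diff HX) Tt t1 (divr_gt0 e0 N0).
exists v; split=> //; apply: (@le_lt_trans _ _ (n.-1%:R * (F v - F t))).
  have : 1 - F v <= 1 - F t by rewrite lerB// (cdf_homo HX i0)// ltW.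
  have -> : F v - F t = (1 - F t) - (1 - F v) by ring.
  rewrite /G; move: (F1_ge0 v) (F1_le1 t) (F1_le1 v) (F1_ge0 t).
  move: (1 - F v) (1 - F t) => b a b0 a1 b1 a0 ba.
  (* Induction on the exponent: [a ^+ k - b ^+ k <= k%:R * (a - b)] for [0 <= b <= a <= 1]. *)
  elim: n.-1 => [|k IHk]; first by rewrite !expr0 subrr mul0r.
  rewrite !exprS -natr1 mulrDl mul1r.
  have -> : a * a ^+ k - b * b ^+ k = a * (a ^+ k - b ^+ k) + b ^+ k * (a - b).
    by ring.
  have ab0 : 0 <= a - b by rewrite subr_ge0.
  apply: lerD; last by rewrite ler_piMl// exprn_ile1.
  by apply: le_trans IHk; rewrite ler_piMl// subr_ge0 lerXn2r// nnegrE.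
by rewrite mulrC -ltr_pdivlMr.
Qed.

Let rP : regular_cost CP (dq CP) (dt CP).
Proof.
apply: cost_regular (CP_diff HA) _ => x t x0 Tt; apply/ltW/(CP_qt_gt0 HA) => //.
exact: ltW.
Qed.

Let rI : regular_cost CI (dq CI) (dt CI).
Proof.
by apply: cost_regular (CI_diff HA) _ => x t x0 Tt; exact/ltW/(CI_qt_gt0 HA).
Qed.

Let CPt_ge0 x t : 0 <= x -> types t -> 0 <= dt CP x t.
Proof. by move=> x0 Tt; exact/ltW/(CP_t_gt0 HA). Qed.

Let CIq_ge0 x t : 0 < x -> types t -> 0 <= dq CI x t.
Proof. by move=> x0 Tt; exact/ltW/(CI_q_gt0 HA). Qed.

Let CIt_ge0 x t : 0 <= x -> types t -> 0 <= dt CI x t.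
Proof.
rewrite le_eqVlt => /predU1P[<-|x0] Tt; last exact/ltW/(CI_t_gt0 HA).
(* At quality [0] the cost vanishes for every type, so the difference quotients are all [0] and
   cannot approach a negative number. *)
rewrite leNgt; apply/negP => l0.
have d0 : 0 < - dt CI 0 t by rewrite oppr_gt0.
have [del del0 H] := derive_inP (cost_t (CI_diff HA) (lexx 0) Tt) d0.
have [v [Tv vt vd]] := types_near Tt del0.
have := H v Tv vt vd; rewrite /diff_quot !(CI_0 HA)// subrr mul0r sub0r.
by rewrite normrN -/(dt CI 0 t) ltr0_norm// ltxx.
Qed.

Let CI_gt0 x t : 0 < x -> types t -> 0 < CI x t.
Proof.
move=> x0 Tt; have sub := qualities_itv (y := x) (lexx 0).
have dC y : 0 <= y <= x -> derivable_in qualities (CI^~ t) y.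
  by move=> /andP[y0 _]; exact: (cost_q (CI_diff HA)).
have [|c cx] := @MVT R (CI^~ t) (fun y => dq CI y t) _ _ x0 _
    (derive_in_within sub dC).
  move=> y; rewrite in_itv /= => /andP[y0].
  by move=> _; exact: (is_derive_dq (CI_diff HA) y0 Tt).
rewrite (CI_0 HA)// !subr0 => ->; rewrite mulr_gt0//.
by apply: (CI_q_gt0 HA) => //; move: cx; rewrite in_itv => /andP[].
Qed.

Let CI_ge0 x t : 0 <= x -> types t -> 0 <= CI x t.
Proof.
rewrite le_eqVlt => /predU1P[<-|x0] Tt; first by rewrite (CI_0 HA).
exact: ltW (CI_gt0 x0 Tt).
Qed.

Let rent1 t := rent q CP CI G t 1.
Let S := eqscore q CP CI G (fine \o s).
Let beta t := (q t, price n F CP CI q t).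

Let rent1_ge0 t : types t -> 0 <= rent1 t.
Proof. by move=> Tt; apply: rent_ge0 => //; exact: types1. Qed.

Let rent11 : rent1 1 = 0.
Proof. by rewrite /rent1 /rent set_itv1 Rintegral_set1. Qed.

Let s_derive x : 0 <= x -> inverse q x < 1 -> is_derive x 1 (fine \o s)
  (dq CP x (inverse q x) + dq CI x (inverse q x) / G (inverse q x)).
Proof. exact: (score_derive Hs). Qed.

Let score_beta t : types t -> t < 1 -> score s (beta t) = (S t)%:E.
Proof.
move=> Tt t1; have fin_s : s (q t) \is a fin_num.
  by apply: (score_fin Hs); rewrite ?inverseK//; exact: (quality_ge0 Hq).
by rewrite /score /= -(fineK fin_s) -EFinB.
Qed.

Let S_lt t u : types t -> types u -> t < u -> u < 1 -> S u < S t.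
Proof.
exact: (eqscore_lt Hq rP rI CPt_ge0 CIt_ge0 CIq_ge0 CI_gt0 G_ge0 G_le1 G_homo
  G_lt s_derive).
Qed.

(** The inequality [deviation x tau t <= rent1 t] solved for [s x]: this form passes to limits and
    makes sense when [s x = -oo]. *)
Let bound tau t x := S tau + CP x t + (rent1 t + CI x t) / G tau.

Let bound_right_cvg tau t x : 0 <= x -> types t ->
  bound tau t y @[y --> x^'+] --> bound tau t x.
Proof.
move=> x0 Tt.
have sub : forall C : R -> R, C y @[y --> within qualities (nbhs x)] --> C x ->
    C y @[y --> x^'+] --> C x.
  move=> C; apply: cvg_trans; apply: cvg_app; apply: within_subset => y /= xy.
  exact: le_trans x0 (ltW xy).
have cP := sub _ (derive_in_cvg (cost_q (CP_diff HA) x0 Tt)).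
have cI := sub _ (derive_in_cvg (cost_q (CI_diff HA) x0 Tt)).
rewrite /bound; apply: cvgD; first by apply: cvgD => //; exact: cvg_cst.
by apply: cvgM; [apply: cvgD => //; exact: cvg_cst|exact: cvg_cst].
Qed.

Let score_le_bound_fin tau t x : types tau -> tau < 1 -> types t ->
  0 <= x -> inverse q x < 1 -> (s x <= (bound tau t x)%:E)%E.
Proof.
move=> Ttau tau1 Tt x0 ix1.
have {}x0' : 0 < x.
  exact: le_lt_trans (quality_ge0 Hq types1) (inverse_lt types1 ix1).
have := deviation_le Hq rP rI CPt_ge0 CIq_ge0 G_ge0 G_le1 G_homo G_lt s_derive
  Ttau tau1 Tt x0' ix1.
rewrite /deviation -/S -/(rent1 t) -(fineK (score_fin Hs x0 ix1)) lee_fin /=.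
rewrite lerBlDr -ler_pdivlMr; last exact: G_gt0.
by rewrite /bound; lra.
Qed.

(** Where [inverse q x = 1], the score is either [-oo] or a limit from the right of scores already
    bounded. *)
Let score_le_bound tau t x : types tau -> tau < 1 -> types t ->
  0 <= x -> (s x <= (bound tau t x)%:E)%E.
Proof.
move=> Ttau tau1 Tt x0; have [ix1|ix1] := ltP (inverse q x) 1.
  exact: score_le_bound_fin.
have {}ix1 : inverse q x = 1.
  by apply/eqP; rewrite eq_le ix1 andbT; case/andP: (types_inverse q x).
have [[y xy iy1]|gap] := pselect (exists2 y, x < y & inverse q y = 1).
  by rewrite (score_below Hs x0 xy iy1) leNye.
have right y : x < y -> inverse q y < 1.
  move=> xy; rewrite lt_neqAle; have /andP[_ ->] := types_inverse q y.
  by rewrite andbT; apply/eqP => iy; apply: gap; exists y.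
apply/lee_addgt0Pr => e e0.
apply: (closed_cvg _ (@closed_ereal_ge_ereal R _) _ _ (score_rcont Hs x0 ix1)).
have bxe : bound tau t x < bound tau t x + e by rewrite ltrDl.
have near_b := cvgr_lt _ (@bound_right_cvg tau _ _ x0 Tt) _ bxe.
near=> y; have xy : x < y by near: y; exact: nbhs_right_gt.
apply: le_trans (score_le_bound_fin Ttau tau1 Tt _ (right y xy)) _.
  exact: le_trans x0 (ltW xy).
by rewrite -EFinD lee_fin ltW//; near: y; exact: near_b.
Unshelve. all: by end_near.
Qed.

Let score_beta_lt t v : priced_types q t -> types v -> v < t ->
  (score s (beta t) < score s (beta v))%E.
Proof.
move=> [Tt Ht] Tv vt; have [t1|t1] := ltP t 1.
  have v1 := lt_trans vt t1.
  by rewrite !score_beta// lte_fin S_lt.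
have {t1} tE : t = 1 by apply/eqP; rewrite eq_le t1 andbT; case/andP: Tt.
subst t; have q1 : q 1 = 0 by case: Ht; rewrite ?ltxx.
have [v0 _] := andP Tv.
(* For type [1] only the weak bound by [S u] is available; an intermediate type [u] makes the
   comparison with [v] strict. *)
pose u := (v + 1) / 2.
have vu : v < u by rewrite /u; lra.
have u1 : u < 1 by rewrite /u; lra.
have Tu : types u by apply: types_between Tv types1 _; rewrite !ltW.
apply: (@le_lt_trans _ _ (S u)%:E); last first.
  have v1 := lt_trans vu u1.
  by rewrite score_beta// lte_fin S_lt.
change (s (q 1) - (price n F CP CI q 1)%:E <= (S u)%:E)%E; rewrite leeBlDr//.
apply: le_trans (score_le_bound Tu u1 types1 (quality_ge0 Hq types1)) _.
rewrite -EFinD lee_fin /bound rent11 /price -/(G 1) G1 q1 (CI_0 HA types1).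
by rewrite !addr0 mul0r invr0 mulr0 !addr0.
Qed.

Let score_beta_le t u : priced_types q t -> priced_types q u ->
  (score s (beta t) <= score s (beta u))%E = (u <= t).
Proof.
move=> pt pu; case: (ltgtP u t) => [ut|tu|->]; last exact: lexx.
  by rewrite ltW// score_beta_lt//; exact: pu.1.
by apply/negbTE; rewrite -ltNge score_beta_lt//; exact: pt.1.
Qed.

Lemma equilibrium_winners (th : 'I_n -> R) : (forall i, priced_types q (th i)) ->
  winners s (fun i => beta (th i)) = [set i | [forall j, th i <= th j]]%SET.
Proof.
move=> pth; apply/setP => i; rewrite !inE; apply: eq_forallb => j.
exact: score_beta_le.
Qed.

Lemma equilibrium_profit i t : priced_types q t ->
  interim_profit X CP CI s (fun=> beta) i t (beta t) = (rent1 t)%:E.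
Proof.
move=> pt; have [Tt Ht] := pt.
rewrite (interim_profit_cutoff HX CP CI i Tt); last 2 first.
- by move=> v Tv _; exact: score_beta_lt.
- by move=> v Tv v1; apply: score_beta_lt => //; split; [|left].
congr EFin; rewrite -/(G t) /=.
case: (ltP t 1) => [t1|t1].
  have : G t != 0 by rewrite gt_eqF// G_gt0.
  rewrite /price -/(G t); have -> : info_rent n F CP CI q t 1 = rent1 t by [].
  by move=> Gt; field.
(* Type [1] wins with probability [0] and, at quality [0], invests nothing, so both sides vanish. *)
have {t1} tE : t = 1 by apply/eqP; rewrite eq_le t1 andbT; case/andP: Tt.
subst t; have q1 : q 1 = 0 by case: Ht; rewrite ?ltxx.
by rewrite G1 rent11 q1 (CI_0 HA types1) mulr0 subr0.
Qed.

Lemma deviation_profit_le i t (b : R * R) : types t -> feasible b ->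
  (interim_profit X CP CI s (fun=> beta) i t b <= (rent1 t)%:E)%E.
Proof.
move=> Tt [b1 b2].
(* The score of [b] may lie in a jump of the equilibrium score, so [b] is compared
   with the scores of types slightly above the cutoff [tau]. *)
pose A := [set v | types v /\
  (v = 0 \/ v < 1 /\ (score s b <= score s (beta v))%E)].
have A0 : A 0 by split; [exact: types0|left].
have supA : has_sup A by split; [exists 0|exists 1 => v [/andP[]]].
pose tau := sup A.
have Ttau : types tau.
  apply/andP; split; first by apply: ub_le_sup => //; exact: supA.2.
  by apply: ge_sup => [|v [/andP[]]//]; exact: supA.1.
have loses v : types v -> v < 1 -> v < tau -> (score s b < score s (beta v))%E.
  move=> Tv v1; rewrite -subr_gt0 => d0.
  have [u [Tu Hu]] := sup_adherent d0 supA; rewrite subKr => vu.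
  case: Hu => [u0|[u1 Hu]].
    by have [v0 _] := andP Tv; move: vu; rewrite u0 ltNge v0.
  by apply: le_lt_trans Hu _; apply: score_beta_lt => //; split; [|left].
have wins v : types v -> v < 1 -> tau < v -> (score s (beta v) < score s b)%E.
  move=> Tv v1 tauv; rewrite ltNge; apply/negP => H.
  have : v <= tau by apply: ub_le_sup; [exact: supA.2|split=> //; right].
  by rewrite leNgt tauv.
rewrite (interim_profit_cutoff HX CP CI i Ttau loses wins) lee_fin -/(G tau).
rewrite leNgt; apply/negP; set a := b.2 - CP b.1 t; set k := CI b.1 t => H.
have k0 : 0 <= k by exact: CI_ge0.
have r0 := rent1_ge0 Tt.
have aG0 : 0 < a * G tau by move: H; lra.
have Gtau0 : 0 < G tau.
  by rewrite lt_neqAle G_ge0 andbT; apply: contraTneq aG0 => <-; rewrite mulr0 ltxx.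
have a0 : 0 < a by move: aG0; rewrite pmulr_lgt0.
have tau1 : tau < 1.
  rewrite lt_neqAle; have /andP[_ ->] := Ttau; rewrite andbT.
  by apply: contraTneq Gtau0 => ->; rewrite G1 ltxx.
(* The excess over [rent1 t] divided by the margin [a]: a smaller loss of winning probability leaves
   a positive excess. *)
have e0 : 0 < (a * G tau - k - rent1 t) / a by rewrite divr_gt0// subr_gt0.
have [v [Tv tauv v1]] := G_right_lim Ttau tau1 e0.
rewrite ltr_pdivlMr// => Gv.
have := wins v Tv v1 tauv; have := score_le_bound Tv v1 Tt b1.
rewrite score_beta// /score.
(* [+oo] contradicts the bound on [s], and [-oo] contradicts winning against type [v]. *)
case: (s b.1) => [r| |] //; rewrite -EFinB lee_fin lte_fin /bound => h1 h2.
have : a < (rent1 t + k) / G v by rewrite /a; move: h1 h2; rewrite -/k; lra.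
rewrite ltr_pdivlMr; last exact: G_gt0.
by move: Gv; rewrite mulrBl ![G _ * a]mulrC; lra.
Qed.

Lemma price_ge0 t : types t -> 0 <= price n F CP CI q t.
Proof.
move=> Tt; have q0 := quality_ge0 Hq Tt; rewrite /price -/(G t).
have -> : info_rent n F CP CI q t 1 = rent1 t by [].
by rewrite addr_ge0 ?(CP_ge0 HA)// divr_ge0// addr_ge0 ?CI_ge0 ?rent1_ge0.
Qed.

Lemma equilibrium_profit_ge0 i t : priced_types q t ->
  (0 <= interim_profit X CP CI s (fun=> beta) i t (beta t))%E.
Proof.
by move=> pt; rewrite equilibrium_profit// lee_fin rent1_ge0//; exact: pt.1.
Qed.

Lemma equilibrium_bayes_nash :
  bayes_nash X CP CI s (priced_types q) (fun=> beta).
Proof.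
move=> i t pt; have Tt := pt.1; split.
  by split; [exact: (quality_ge0 Hq)|exact: price_ge0].
by move=> b fb; rewrite equilibrium_profit//; exact: deviation_profit_le.
Qed.

End Equilibrium.

Theorem proposition2 (R : realType) (d : measure_display)
    (Omega : measurableType d) (P : probability Omega R)
    (n : nat) (n_ge2 : (2 <= n)%N)
    (X : 'I_n -> {RV P >-> R}) (F f V : R -> R) (CP CI : R -> R -> R)
    (HX : type_model X F f) (HA : standing_assumptions F f V CP CI)
    (q : R -> R) (Hq : quality_function q)
    (s : R -> \bar R) (Hs : score_rule n F CP CI q s) :
  let strategy := fun (_ : 'I_n) (t : R) => (q t, price n F CP CI q t) in
  [/\ bayes_nash X CP CI s (priced_types q) strategy,
      forall th : 'I_n -> R, (forall i, priced_types q (th i)) ->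
        winners s (fun i => strategy i (th i))
          = [set i | [forall j, th i <= th j]]%SET
    & forall (i : 'I_n) (t : R), priced_types q t ->
        (0 <= interim_profit X CP CI s strategy i t (strategy i t))%E].
Proof.
split.
- exact: (equilibrium_bayes_nash n_ge2 HX HA Hq Hs).
- exact: (equilibrium_winners n_ge2 HX HA Hq Hs).
- exact: (equilibrium_profit_ge0 n_ge2 HX HA Hq Hs).
Qed.
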